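(* Let $d\ge 1$ be an integer, $\gamma>0$, and let $(\gamma_n)$ be a sequence of positive reals with $\gamma_n\sim\gamma$ as $n\to\infty$. For $\delta\in(0,1)$ let $r_n=\gamma_n n^{-(1-\delta)/d}$, let $\overline{c}(\delta)$ denote the smallest integer $c$ for which $$\lim_{n\to\infty}\mathbf{P}(\Gamma_n(r_n,c)\text{ is connected})=1,$$ and let $\underline{c}(\delta)$ denote the largest integer $c$ for which $$\lim_{n\to\infty}\mathbf{P}(\Gamma_n(r_n,c)\text{ is disconnected})=1.$$ Then, for any $\epsilon>0$, we have, for all $\delta$ small enough, $$(1-\epsilon)\,\delta^{-1/2}\le\underline{c}(\delta)\le\overline{c}(\delta)\le(1+\epsilon)\,\delta^{-1/2}.$$
   Context: Let $X_1,\dots,X_n$ be independent, uniformly distributed random points in $[0,1]^d$, and $\mathbf{X}=\{X_1,\dots,X_n\}$. Let $D(x,y)=\big(\sum_{i=1}^d\min(|x_i-y_i|,1-|x_i-y_i|)^2\big)^{1/2}$ be the Euclidean distance on the unit torus. For $r_n>0$, the random geometric graph $G_n(r_n)$ has vertex set $\mathbf{X}$, and distinct $X_i,X_j$ are joined by an edge if and only if $D(X_i,X_j)\le r_n$. Given a nonnegative integer $c$, the random Bluetooth graph $\Gamma_n(r_n,c)$ is the following random subgraph of $G_n(r_n)$: conditionally on $\mathbf{X}$, each vertex $X_i$, independently of the other vertices, selects uniformly at random without replacement $c$ of the edges of $G_n(r_n)$ adjacent to $X_i$ (all of them if its degree in $G_n(r_n)$ is less than $c$). $\Gamma_n(r_n,c)$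 is the undirected graph with vertex set $\mathbf{X}$ whose edges are the edges selected by at least one of their endpoints. *)

(* Defs.v *)
From HB Require Import structures.
From mathcomp Require Import all_boot all_order all_algebra.
From mathcomp Require Import all_classical all_reals all_analysis.
Set Implicit Arguments.
Unset Strict Implicit.
Unset Printing Implicit Defensive.
Import Order.TTheory GRing.Theory Num.Theory.
Import numFieldNormedType.Exports.
Local Open Scope classical_set_scope.
Local Open Scope ring_scope.

Definition torus_dist (R : realType) (d : nat) (x y : d.-tuple R) : R :=
  Num.sqrt (\sum_(k < d)
    Num.min `|tnth x k - tnth y k| (1 - `|tnth x k - tnth y k|) ^+ 2).

(* Vertices are represented by the indices 'I_n of the points, which are
   almost surely distinct. *)
Definition rgg_adj (R : realType) (d n : nat) (r : R)
    (x : n.-tuple (d.-tuple R)) : rel 'I_n :=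
  fun i j => (i != j) && (torus_dist (tnth x i) (tnth x j) <= r).

Definition rgg_nbrs (R : realType) (d n : nat) (r : R)
    (x : n.-tuple (d.-tuple R)) (i : 'I_n) : {set 'I_n} :=
  [set j | rgg_adj r x i j]%SET.

(* An edge chosen by i is identified with its other endpoint, so a choice of i
   is a set of neighbours. *)
Definition admissible_choices (R : realType) (d n : nat) (r : R) (c : nat)
    (x : n.-tuple (d.-tuple R)) (i : 'I_n) : {set {set 'I_n}} :=
  [set A : {set 'I_n} |
    (A \subset rgg_nbrs r x i) && (#|A| == minn c #|rgg_nbrs r x i|)]%SET.

Definition choice_prob (R : realType) (d n : nat) (r : R) (c : nat)
    (x : n.-tuple (d.-tuple R)) (i : 'I_n) (A : {set 'I_n}) : R :=
  if A \in admissible_choices r c x i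
  then #|admissible_choices r c x i|%:R^-1 else 0.

Definition selected_adj (n : nat) (s : {ffun 'I_n -> {set 'I_n}}) : rel 'I_n :=
  fun i j => (j \in s i) || (i \in s j).

Definition graph_connected (n : nat) (e : rel 'I_n) : Prop :=
  forall i j : 'I_n, connect e i j.

Local Open Scope ereal_scope.

Record bluetooth_graph (R : realType) (d n : nat) (r : R) (c : nat) := {
  bt_display : measure_display ;
  bt_space : measurableType bt_display ;
  bt_prob : probability bt_space R ;
  bt_points : bt_space -> n.-tuple (d.-tuple R) ;
  bt_choices : bt_space -> {ffun 'I_n -> {set 'I_n}} ;
  bt_points_measurable : measurable_fun [set: bt_space] bt_points ;
  bt_choices_measurable : forall s : {ffun 'I_n -> {set 'I_n}},
    measurable (bt_choices @^-1` [set s]) ;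
  (* each point is uniform on the cube: its law is the d-fold product of the
     uniform law on `[0, 1], given by its values on measurable rectangles *)
  bt_points_uniform : forall (i : 'I_n) (A : 'I_d -> set R),
    (forall k, measurable (A k)) ->
    bt_prob [set w | forall k, A k (tnth (tnth (bt_points w) i) k)] =
      \prod_(k < d) uniform_prob (@ltr01 R) (A k) ;
  (* taking some B i = setT gives the product rule for every subfamily *)
  bt_points_independent : forall B : 'I_n -> set (d.-tuple R),
    (forall i, measurable (B i)) ->
    bt_prob [set w | forall i, B i (tnth (bt_points w) i)] =
      \prod_(i < n) bt_prob [set w | B i (tnth (bt_points w) i)] ;
  (* the conditional law of the choices given the points is the product of the
     uniform laws on the admissible choices of the vertices *)
  bt_choices_law : forall (B : set (n.-tuple (d.-tuple R)))
      (s : {ffun 'I_n -> {set 'I_n}}),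
    measurable B ->
    bt_prob (bt_points @^-1` B `&` bt_choices @^-1` [set s]) =
      \int[bt_prob]_(w in bt_points @^-1` B)
        (\prod_(i < n) choice_prob r c (bt_points w) i (s i))%:E
}.

Definition prob_connected (R : realType) (d n : nat) (r : R) (c : nat)
    (G : bluetooth_graph d n r c) : \bar R :=
  bt_prob G [set w | graph_connected (selected_adj (bt_choices w))].

Definition prob_disconnected (R : realType) (d n : nat) (r : R) (c : nat)
    (G : bluetooth_graph d n r c) : \bar R :=
  bt_prob G [set w | ~ graph_connected (selected_adj (bt_choices w))].

Definition is_smallest (Q : nat -> Prop) (c : nat) : Prop :=
  Q c /\ forall c', Q c' -> (c <= c')%N.

Definition is_largest (Q : nat -> Prop) (c : nat) : Prop :=
  Q c /\ forall c', Q c' -> (c' <= c)%N.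

Local Close Scope ereal_scope.

Definition bt_radius (R : realType) (d : nat) (gamma_ : nat -> R) (delta : R)
    (n : nat) : R :=
  gamma_ n * n%:R `^ (- ((1 - delta) / d%:R)).

(* Main.v *)
(** The threshold is c^2 delta = 1. Cut the torus into m^d cells whose side is a
small multiple of the visibility radius; a cell holds about lam points, where lam
is of order n^delta, and by a Chernoff bound all cells are balanced with high
probability. Conditionally on a balanced configuration the choices are finite
product measures, and both directions become statements about fixed graphs.

If c^2 delta < 1, the expected number of sets of c + 1 points of one cell that
choose exactly each other and are chosen by nobody else is of order
(n / lam) lam^(c + 1) lam^(- c (c + 1)) = n lam^(- c^2), which tends to infinity;
Chebyshev's inequality provides such an isolated clique.

If c^2 delta > 1 and c is large, let S be a union of components. Two adjacent
cells form a clique, and for c large no subset of such a clique of intermediate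
density is closed, so that S or its complement is sparse in every cell. A
nonempty sparse S is excluded by union bounds. If some cell contains at least 8c
points of S, take a cell with the largest number t of them: their choices fall
among at most K t visible points of S. Otherwise S has polynomial growth, and a
ball exists in which S has w points and whose neighbourhood contains only
u <= (1 + 1 / (5 c)) w points of S; all choices of the former are among the
latter, with total probability at most n lam^(u - 1 - c w) up to constants, and
u - 1 - c w <= - c^2.

No coupling in c is needed: every c below delta^(-1/2) gives a disconnected
graph and every c above it a connected one, which locates both thresholds. *)
Require Import Defs.
From HB Require Import structures.
From mathcomp Require Import all_boot all_order all_algebra.
From mathcomp Require Import all_classical all_reals all_analysis.
From mathcomp Require Import zify ring lra.
Import Order.TTheory GRing.Theory Num.Theory.
Import numFieldNormedType.Exports.
Set Implicit Arguments.
Unset Strict Implicit.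
Unset Printing Implicit Defensive.
Local Open Scope ring_scope.

(** * Uniform choices of neighbours in a fixed graph *)

Section FiniteChoices.
Variables (R : realType) (V : finType).
Implicit Types (c : nat) (N U A : {set V}) (E : pred {set V}).

Definition choices c N : {set {set V}} :=
  [set A : {set V} | (A \subset N) && (#|A| == minn c #|N|)]%SET.

Definition choice_pr c N A : R :=
  if A \in choices c N then #|choices c N|%:R^-1 else 0.

Definition vertex_pr c N E : R := \sum_(A | E A) choice_pr c N A.

Definition graph_pr c (g : V -> {set V}) (P : pred {ffun V -> {set V}}) : R :=
  \sum_(s | P s) \prod_v choice_pr c (g v) (s v).

Lemma choice_pr_ge0 c N A : 0 <= choice_pr c N A.
Proof. by rewrite /choice_pr; case: ifP => // _; rewrite invr_ge0 ler0n. Qed.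

Lemma card_choices c N : #|choices c N| = 'C(#|N|, minn c #|N|).
Proof. by rewrite -cards_draws; apply: eq_card => A; rewrite !inE. Qed.

Lemma card_choices_gt0 c N : (0 < #|choices c N|)%N.
Proof. by rewrite card_choices bin_gt0 geq_minr. Qed.

Lemma vertex_prE c N E :
  vertex_pr c N E = #|[set A in choices c N | E A]|%:R / 'C(#|N|, minn c #|N|)%:R.
Proof.
rewrite /vertex_pr /choice_pr -big_mkcondr /= card_choices sumr_const -[LHS]mulr_natl.
rewrite (_ : #|_| = #|[set A in choices c N | E A]|)//.
by apply: eq_card => A; rewrite unfold_in [in RHS]inE andbC.
Qed.

Lemma vertex_pr_ge0 c N E : 0 <= vertex_pr c N E.
Proof. by apply: sumr_ge0 => A _; exact: choice_pr_ge0. Qed.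

Lemma vertex_prT c N : vertex_pr c N xpredT = 1.
Proof.
rewrite vertex_prE -card_choices.
have -> : #|[set A in choices c N | true]| = #|choices c N|.
  by apply: eq_card => A; rewrite !inE andbT.
by rewrite divff // pnatr_eq0 -lt0n card_choices_gt0.
Qed.

Lemma le_vertex_pr c N E1 E2 :
  (forall A, A \in choices c N -> E1 A -> E2 A) ->
  vertex_pr c N E1 <= vertex_pr c N E2.
Proof.
move=> h; rewrite !vertex_prE ler_wpM2r ?invr_ge0 ?ler0n// ler_nat.
apply/subset_leq_card/fintype.subsetP => A; rewrite !inE => /andP[cA EA].
by rewrite cA h// inE.
Qed.

Lemma vertex_pr1 c N A : (c <= #|N|)%N -> A \subset N -> #|A| = c ->
  vertex_pr c N (pred1 A) = 'C(#|N|, c)%:R^-1.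
Proof.
move=> cN AN cA; rewrite /vertex_pr big_pred1_eq /choice_pr card_choices.
by rewrite inE AN (minn_idPl cN) cA eqxx.
Qed.

Lemma vertex_pr_sub c N U : (c <= #|N|)%N ->
  vertex_pr c N [pred A : {set V} | A \subset U] = 'C(#|N :&: U|, c)%:R / 'C(#|N|, c)%:R.
Proof.
move=> cN; rewrite vertex_prE (minn_idPl cN) -(cards_draws (N :&: U)).
rewrite (_ : #|_| = #|[set A : {set V} | A \subset N :&: U & #|A| == c]|)//.
apply: eq_card => A.
by rewrite !inE /= (minn_idPl cN) finset.subsetI andbAC.
Qed.

Lemma vertex_pr_disjoint c N U : (c <= #|N|)%N ->
  vertex_pr c N [pred A : {set V} | [disjoint A & U]] =
  'C(#|N| - #|N :&: U|, c)%:R / 'C(#|N|, c)%:R.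
Proof.
move=> cN.
have -> : (#|N| - #|N :&: U| = #|N :&: ~: U|)%N.
  by rewrite -(cardsID U N) finset.setDE; lia.
rewrite -vertex_pr_sub//; apply: eq_bigl => A /=.
by rewrite fintype.subset_disjoint; apply: eq_disjoint_r => x; rewrite !inE negbK.
Qed.

Lemma ffact_leX n m : (n ^_ m <= n ^ m)%N.
Proof.
elim: m n => [|m IH] n; first by rewrite ffactn0.
by rewrite ffactnSr expnSr leq_mul// leq_subr.
Qed.

(** The comparison is factor by factor: [(x - i) * D <= x * (D - i)] because [x <= D]. Drawing
    without replacement thus hits a subset at most as often as drawing with replacement. *)
Lemma ffact_ratio x D c : (x <= D)%N -> (x ^_ c * D ^ c <= x ^ c * D ^_ c)%N.
Proof.
move=> xD; elim: c => [|c IH]; first by rewrite !ffactn0 !expn0.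
rewrite !ffactnSr !expnS.
have h : ((x - c) * D <= x * (D - c))%N.
  by rewrite mulnBl mulnBr; have := leq_mul2l c x D; rewrite xD orbT; lia.
by have := leq_mul IH h; lia.
Qed.

Lemma bin_ratio x D c : (x <= D)%N -> (0 < D)%N ->
  'C(x, c)%:R / 'C(D, c)%:R <= (x%:R / D%:R) ^+ c :> R.
Proof.
move=> xD D0; case: (leqP c D) => cD; last first.
  rewrite [X in _ / X%:R]bin_small// invr0 mulr0.
  by rewrite exprn_ge0// divr_ge0.
have bD : 0 < 'C(D, c)%:R :> R by rewrite ltr0n bin_gt0.
have pD : 0 < D%:R ^+ c :> R by rewrite exprn_gt0// ltr0n.
rewrite expr_div_n ler_pdivrMr// mulrAC ler_pdivlMr//.
have := ffact_ratio c xD.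
rewrite -!bin_ffact -(ler_nat R) !natrM !natrX.
by rewrite mulrAC mulrA ler_pM2r// ltr0n fact_gt0.
Qed.

Lemma vertex_pr_sub_le c N U : (c <= #|N|)%N -> (0 < #|N|)%N ->
  vertex_pr c N [pred A : {set V} | A \subset U] <= (#|N :&: U|%:R / #|N|%:R) ^+ c.
Proof.
by move=> cN N0; rewrite vertex_pr_sub// bin_ratio// subset_leq_card// finset.subsetIl.
Qed.

Lemma vertex_pr_disjoint_le c N U : (c <= #|N|)%N -> (0 < #|N|)%N ->
  vertex_pr c N [pred A : {set V} | [disjoint A & U]] <=
  expR (- (c%:R * #|N :&: U|%:R / #|N|%:R)).
Proof.
move=> cN N0; rewrite vertex_pr_disjoint//.
apply: le_trans (bin_ratio _ (leq_subr _ _) N0) _.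
have h : (#|N :&: U| <= #|N|)%N by rewrite subset_leq_card// finset.subsetIl.
have N0' : #|N|%:R != 0 :> R by rewrite pnatr_eq0 -lt0n.
rewrite natrB// mulrBl divff// -mulrA -[X in expR X]mulrN expRM_natl.
rewrite lerXn2r ?nnegrE ?expR_ge0// ?expR_ge1Dx//.
by rewrite subr_ge0 ler_pdivrMr ?ltr0n// mul1r ler_nat.
Qed.

Lemma subn_expn_le_ffact a c : ((a - c) ^ c <= a ^_ c)%N.
Proof.
have : forall k, (k <= c)%N -> ((a - c) ^ k <= a ^_ k)%N.
  elim=> [|k IH] kc; first by rewrite expn0 ffactn0.
  by rewrite expnSr ffactnSr leq_mul//; [exact: IH (ltnW kc) | lia].
exact.
Qed.

(** Each of the [c] factors of the falling factorial in the numerator is at least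
    [#|N| - #|N :&: U| - c], while those in the denominator are at most [#|N|]. *)
Lemma vertex_pr_disjoint_ge c N U : (c <= #|N|)%N -> (0 < #|N|)%N ->
  (#|N :&: U| + c <= #|N|)%N ->
  (1 - (#|N :&: U| + c)%:R / #|N|%:R) ^+ c <=
  vertex_pr c N [pred A : {set V} | [disjoint A & U]].
Proof.
move=> cN N0 UN; rewrite vertex_pr_disjoint//.
have N0' : #|N|%:R != 0 :> R by rewrite pnatr_eq0 -lt0n.
have -> : 1 - (#|N :&: U| + c)%:R / #|N|%:R
  = (#|N| - #|N :&: U| - c)%:R / #|N|%:R :> R.
  by rewrite -subnDA natrB// mulrBl divff.
rewrite expr_div_n ler_pdivrMr ?exprn_gt0 ?ltr0n// mulrAC.
rewrite ler_pdivlMr ?ltr0n ?bin_gt0// -!natrX -!natrM ler_nat.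
rewrite -(leq_pmul2r (fact_gt0 c)) -mulnA bin_ffact.
rewrite mulnAC bin_ffact leq_mul//; first exact: subn_expn_le_ffact.
exact: ffact_leX.
Qed.

(** This is negative correlation in disguise: for a random [c]-subset, avoiding one set makes it
    less likely to avoid a second, disjoint one. *)
Lemma ffact_logconcave a b D c :
  ((D - a - b) ^_ c * D ^_ c <= (D - a) ^_ c * (D - b) ^_ c)%N.
Proof.
elim: c => [|c IH]; first by rewrite !ffactn0.
rewrite !ffactnSr.
have h : ((D - a - b - c) * (D - c) <= (D - a - c) * (D - b - c))%N.
  (* When [D] is less than [a + b + c], truncated subtraction makes the left side zero. *)
  case: (leqP (a + b + c) D) => [|]; last by move=> ?; have -> : (D - a - b - c = 0)%N by lia.
  move=> abc; have [e ->] : exists e, D = (e + (a + b + c))%N by exists (D - (a + b + c))%N; lia.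
  have -> : (e + (a + b + c) - a - b - c = e)%N by lia.
  have -> : (e + (a + b + c) - a - c = e + b)%N by lia.
  have -> : (e + (a + b + c) - b - c = e + a)%N by lia.
  have -> : (e + (a + b + c) - c = e + a + b)%N by lia.
  nia.
by have := leq_mul IH h; lia.
Qed.

Lemma vertex_pr_disjointU c N U1 U2 : (c <= #|N|)%N -> [disjoint U1 & U2] ->
  vertex_pr c N [pred A : {set V} | [disjoint A & U1 :|: U2]] <=
  vertex_pr c N [pred A : {set V} | [disjoint A & U1]] *
  vertex_pr c N [pred A : {set V} | [disjoint A & U2]].
Proof.
move=> cN dU; rewrite !vertex_pr_disjoint//.
have b0 : 0 < 'C(#|N|, c)%:R :> R by rewrite ltr0n bin_gt0.
have f0 : 0 < (c`!)%:R :> R by rewrite ltr0n fact_gt0.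
have -> : #|N :&: (U1 :|: U2)| = (#|N :&: U1| + #|N :&: U2|)%N.
  rewrite finset.setIUr cardsU.
  suff -> : (N :&: U1 :&: (N :&: U2) = finset.set0)%SET by rewrite cards0 subn0.
  apply/eqP; rewrite setI_eq0; apply: disjointWl (finset.subsetIr _ _) _.
  exact: disjointWr (finset.subsetIr _ _) dU.
rewrite mulf_div ler_pdivrMr// mulrAC ler_pdivlMr ?mulr_gt0//.
rewrite -!natrM ler_nat.
have := ffact_logconcave #|N :&: U1| #|N :&: U2| #|N| c.
rewrite -!bin_ffact subnDA => h.
have := fact_gt0 c; nia.
Qed.

Variable (c : nat) (g : V -> {set V}).
Implicit Types (P Q : pred {ffun V -> {set V}}).

Lemma graph_pr_ge0 P : 0 <= graph_pr c g P.
Proof. by apply: sumr_ge0 => s _; apply: prodr_ge0 => v _; exact: choice_pr_ge0. Qed.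

Lemma graph_pr_forall (E : V -> pred {set V}) :
  graph_pr c g [pred s : {ffun V -> {set V}} | [forall v, E v (s v)]] = \prod_v vertex_pr c (g v) (E v).
Proof.
rewrite /vertex_pr bigA_distr_big_dep; apply: eq_bigl => s /=.
by apply/forallP/familyP => h v; have := h v.
Qed.

Lemma graph_prT : graph_pr c g xpredT = 1.
Proof.
have := graph_pr_forall (fun=> xpredT).
rewrite (eq_bigr (fun=> 1)) => [|v _]; last by rewrite vertex_prT.
rewrite big1_eq => <-; apply: eq_bigl => s /=; apply/esym/forallP => //.
Qed.

Lemma le_graph_pr P Q : (forall s, P s -> Q s) -> graph_pr c g P <= graph_pr c g Q.
Proof.
move=> PQ; rewrite /graph_pr big_mkcond [leRHS]big_mkcond; apply: ler_sum => s _.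
case: ifP => [/PQ -> //|_]; case: ifP => // _.
by apply: prodr_ge0 => v _; exact: choice_pr_ge0.
Qed.

Lemma graph_pr_le1 P : graph_pr c g P <= 1.
Proof. by rewrite -graph_prT; apply: le_graph_pr. Qed.

(** A union bound in which only admissible choices have to be covered: any other [s] carries a
    factor zero in its weight. *)
Lemma graph_pr_union (I : finType) (F : pred I) P (Q : I -> pred {ffun V -> {set V}}) :
  (forall s : {ffun V -> {set V}}, (forall v, s v \in choices c (g v)) -> P s ->
    exists2 k, F k & Q k s) ->
  graph_pr c g P <= \sum_(k | F k) graph_pr c g (Q k).
Proof.
move=> PQ; rewrite /graph_pr; under [leRHS]eq_bigr do rewrite big_mkcond.
rewrite exchange_big /= big_mkcond; apply: ler_sum => s _.
have p0 : 0 <= \prod_v choice_pr c (g v) (s v).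
  by apply: prodr_ge0 => v _; exact: choice_pr_ge0.
have sum0 (F' : pred I) : 0 <= \sum_(k | F' k)
    (if Q k s then \prod_v choice_pr c (g v) (s v) else 0).
  by apply: sumr_ge0 => k _; case: ifP.
case: ifP => [Ps|_]; last exact: sum0.
have [/forallP/(PQ s)/(_ Ps)[k Fk Qk]|/forallPn[v sv]] :=
  boolP [forall v, s v \in choices c (g v)].
  by rewrite (bigD1 k)//= Qk lerDl.
by rewrite [leLHS](bigD1 v)//= /choice_pr (negPf sv) mul0r.
Qed.

Lemma graph_pr_forall_in (W : {set V}) (E : V -> pred {set V}) :
  graph_pr c g [pred s : {ffun V -> {set V}} | [forall v in W, E v (s v)]] =
  \prod_(v in W) vertex_pr c (g v) (E v).
Proof.
rewrite big_mkcond /= (eq_bigr (fun v => vertex_pr c (g v) (fun A => (v \in W) ==> E v A))).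
  by rewrite -graph_pr_forall; apply: eq_bigl => s /=.
move=> v _; case: ifP => // _; rewrite -(vertex_prT c (g v)); exact: eq_bigl.
Qed.

Lemma graph_pr_forall_in_le (W : {set V}) (E : V -> pred {set V}) (a : R) :
  (forall v, v \in W -> vertex_pr c (g v) (E v) <= a) ->
  graph_pr c g [pred s : {ffun V -> {set V}} | [forall v in W, E v (s v)]] <= a ^+ #|W|.
Proof.
move=> h; rewrite graph_pr_forall_in -prodr_const.
by apply: ler_prod => v vW; rewrite vertex_pr_ge0 h.
Qed.

End FiniteChoices.

(** * Graphs built on a grid of cells *)

(* Closeness on the cyclic group of order m; the last two cases wrap around. *)
Definition torus_near (m rho a b : nat) : bool :=
  [|| (a <= b + rho) && (b <= a + rho), m + a <= b + rho | m + b <= a + rho]%N.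

Section Grid.
Variables (d m : nat).
Local Notation cells := {ffun 'I_d -> 'I_m}.
Implicit Types (p q s : cells).

Definition cell_near (rho : nat) p q := [forall k, torus_near m rho (p k) (q k)].

(** In contrast with [cell_near], there is no wrapping around: this relation already connects the
    grid, and it implies closeness on the torus. *)
Definition cell_adj p q :=
  [forall k, ((p k <= (q k).+1) && (q k <= (p k).+1))%N].

Lemma cell_near_trans rho1 rho2 p q s :
  cell_near rho1 p q -> cell_near rho2 q s -> cell_near (rho1 + rho2) p s.
Proof.
move=> /forallP h1 /forallP h2; apply/forallP => k.
have := h1 k; have := h2 k; rewrite /torus_near.
have := ltn_ord (p k); have := ltn_ord (q k); have := ltn_ord (s k).
lia.
Qed.

Lemma cell_near_refl rho p : cell_near rho p p.
Proof. by apply/forallP => k; rewrite /torus_near leq_addr. Qed.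

Lemma card_torus_near rho (a : 'I_m) :
  (#|[set b : 'I_m | torus_near m rho a b]%SET| <= 4 * rho + 1)%N.
Proof.
(* The three ranges contain the direct window around [a], the values reached by passing [m] upwards,
   and those reached by passing 0 downwards. *)
pose s := (iota (a - rho) (2 * rho + 1) ++ iota 0 rho ++ iota (m - rho) rho)%N.
have -> : (4 * rho + 1 = size s)%N by rewrite !size_cat !size_iota; lia.
rewrite cardE -(size_map val); apply: uniq_leq_size.
  by rewrite map_inj_uniq ?enum_uniq//; exact: val_inj.
move=> x /mapP[b]; rewrite mem_enum inE /torus_near => h ->.
rewrite !mem_cat !mem_iota; have bm := ltn_ord b; have am := ltn_ord a.
by rewrite (erefl : val b = nat_of_ord b); move: h; lia.
Qed.

Lemma card_forall (T : finType) (P : 'I_d -> pred T) :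
  #|[set f : {ffun 'I_d -> T} | [forall k, P k (f k)]]%SET| =
  (\prod_k #|[set b | P k b]%SET|)%N.
Proof.
under eq_bigr do rewrite -sum1_card.
rewrite bigA_distr_big_dep /= -sum1_card; apply: eq_big => [f|f _].
  by rewrite inE; apply/forallP/familyP => h k; have := h k; rewrite ?inE.
by rewrite big1.
Qed.

Lemma card_cell_near rho p :
  (#|[set q | cell_near rho p q]%SET| <= (4 * rho + 1) ^ d)%N.
Proof.
rewrite (card_forall (fun k (b : 'I_m) => torus_near m rho (p k) b)).
rewrite -[X in (_ <= _ ^ X)%N](card_ord d) -prod_nat_const.
by apply: leq_prod => k _; exact: card_torus_near.
Qed.

Lemma cell_adj_connected (P : pred cells) :
  (forall p q, cell_adj p q -> P p -> P q) -> forall p q, P p -> P q.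
Proof.
move=> adjP p q.
suff : forall l p, (forall k, (p k <= q k + l)%N && (q k <= p k + l)%N) -> P p -> P q.
  move=> h; apply: (h m p)=> k; have := ltn_ord (p k); have := ltn_ord (q k); lia.
move=> {p}; elim=> [|l IH] p pq Pp.
  suff -> : q = p by [].
  by apply/ffunP => k; apply/val_inj; have := pq k => /=; lia.
(* All coordinates move one step towards [q] at once, so that the largest coordinate difference
   drops by one. *)
pose step k : nat := if (p k < q k)%N then (p k).+1 else if (q k < p k)%N then (p k).-1 else p k.
have stepm k : (step k < m)%N.
  have := ltn_ord (p k); have := ltn_ord (q k); rewrite /step.
  by case: ifP; [lia | case: ifP; lia].
pose p' : cells := [ffun k => Ordinal (stepm k)].
apply: (IH p').
  move=> k; rewrite ffunE /= /step; have := pq k.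
  by case: ifP; [lia | case: ifP; lia].
apply: adjP Pp; apply/forallP => k; rewrite ffunE /= /step.
by case: ifP; [lia | case: ifP; lia].
Qed.

End Grid.

(* A fixed configuration of points, seen through the grid of m^d cells of the
   torus: lam is the expected number of points in a cell, and kappa is the
   visibility radius measured in cells. *)
Record cellular (R : realType) (d m kappa : nat) (V : finType) (lam : R)
    (g : V -> {set V}) (cell : V -> {ffun 'I_d -> 'I_m}) : Prop := Cellular {
  nbr_irrefl : forall v, v \notin g v ;
  nbr_sym : forall u v, (u \in g v) = (v \in g u) ;
  nbr_adj : forall u v, u != v -> cell_adj (cell v) (cell u) -> u \in g v ;
  nbr_near : forall u v, u \in g v -> cell_near kappa (cell v) (cell u) ;
  cell_card_ge : forall q, lam / 4 <= #|[set v | cell v == q]%SET|%:R ;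
  cell_card_le : forall q, #|[set v | cell v == q]%SET|%:R <= 4 * lam
}.

Section Cellular.
Variables (R : realType) (d m kappa : nat) (V : finType) (lam : R).
Variables (g : V -> {set V}) (cell : V -> {ffun 'I_d -> 'I_m}).
Hypothesis Hc : cellular kappa lam g cell.
Local Notation cells := {ffun 'I_d -> 'I_m}.
Local Notation K := ((4 * kappa + 1) ^ d)%N.

Definition block (q : cells) : {set V} := [set v | cell v == q]%SET.
Definition cell_ball (rho : nat) (q : cells) : {set V} := [set v | cell_near rho q (cell v)]%SET.

Lemma blockE q : block q = [set v | cell v == q]%SET. Proof. by []. Qed.

Lemma card_fibers (A : {set V}) (Q : {set cells}) :
  (forall v, v \in A -> cell v \in Q) -> (#|A| = \sum_(q in Q) #|A :&: block q|)%N.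
Proof.
move=> AQ; rewrite -sum1_card (partition_big cell (mem Q))//=.
apply: eq_bigr => q _; rewrite -sum1_card; apply: eq_bigl => v.
by rewrite !inE.
Qed.

Lemma card_ball_fibers (A : {set V}) rho q t : A \subset cell_ball rho q ->
  (forall q', (#|A :&: block q'| <= t)%N) -> (#|A| <= (4 * rho + 1) ^ d * t)%N.
Proof.
move=> AB ht; rewrite (@card_fibers _ [set q' | cell_near rho q q']%SET); last first.
  by move=> v /(fintype.subsetP AB); rewrite !inE.
apply: (@leq_trans (\sum_(q' in [set q' | cell_near rho q q']%SET) t)%N).
  by apply: leq_sum => q' _; exact: ht.
by rewrite sum_nat_const leq_mul// card_cell_near.
Qed.

Lemma card_ball rho q : #|cell_ball rho q|%:R <= ((4 * rho + 1) ^ d)%:R * (4 * lam) :> R.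
Proof.
rewrite (@card_fibers _ [set q' | cell_near rho q q']%SET); last by move=> v; rewrite !inE.
rewrite natr_sum.
apply: (@le_trans _ _ (\sum_(q' in [set q' | cell_near rho q q']%SET) (4 * lam))).
  apply: ler_sum => q' _; apply: le_trans (cell_card_le Hc q'); rewrite ler_nat subset_leq_card//.
  exact: finset.subsetIr.
rewrite sumr_const -[leLHS]mulr_natl ler_wpM2r ?ler_nat ?card_cell_near//.
exact: le_trans (cell_card_le Hc q).
Qed.

Lemma nbr_ball v : g v \subset cell_ball kappa (cell v).
Proof. by apply/fintype.subsetP => u /(nbr_near Hc); rewrite inE. Qed.

Lemma deg_le v : #|g v|%:R <= K%:R * (4 * lam) :> R.
Proof.
by apply: le_trans (card_ball kappa (cell v)); rewrite ler_nat subset_leq_card// nbr_ball.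
Qed.

(** All other points of the cell of [v] are neighbours; the loss of [v] itself is absorbed by
    [lam / 4 - 1 >= lam / 8]. *)
Lemma deg_ge v : 8 <= lam -> lam / 8 <= #|g v|%:R :> R.
Proof.
move=> lam8; have : (#|block (cell v)| <= #|g v| + 1)%N.
  rewrite (cardsD1 v (block _)) addnC leq_add//; last by case: (_ \in _).
  apply/subset_leq_card/fintype.subsetP => u; rewrite !inE => /andP[uv /eqP cu].
  by apply: (nbr_adj Hc) => //; rewrite cu; apply/forallP => k; rewrite !leqnSn.
rewrite -(ler_nat R) natrD; have := cell_card_ge Hc (cell v); rewrite -blockE.
set x := #|_|%:R; set y := #|_|%:R; lra.
Qed.

Lemma cells_le : #|{: cells}|%:R * lam <= 4 * #|V|%:R.
Proof.
have := @card_fibers [set: V]%SET [set: cells]%SET.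
rewrite cardsT => ->//; last by move=> ? _; rewrite !inE.
rewrite natr_sum -cardsT -sumr_const mulr_suml mulr_sumr.
apply: ler_sum => q _; rewrite mul1r finset.setTI.
by have := cell_card_ge Hc q; rewrite -blockE; lra.
Qed.

Lemma cells_ge : #|V|%:R <= #|{: cells}|%:R * (4 * lam).
Proof.
have := @card_fibers [set: V]%SET [set: cells]%SET.
rewrite cardsT => ->//; last by move=> ? _; rewrite !inE.
rewrite natr_sum -cardsT -sumr_const mulr_suml.
apply: ler_sum => q _; rewrite mul1r finset.setTI.
exact: (cell_card_le Hc q).
Qed.

End Cellular.

(** * Isolated cliques *)

Section RealBounds.
Variable R : realType.

Lemma bernoulli_le (x : R) n : 0 <= x <= 1 -> 1 - n%:R * x <= (1 - x) ^+ n.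
Proof.
move=> /andP[x0 x1]; elim: n => [|n IH]; first by rewrite mul0r subr0 expr0.
rewrite exprS -natr1; apply: (@le_trans _ _ ((1 - x) * (1 - n%:R * x))).
  have h : 0 <= n%:R * x * x by rewrite !mulr_ge0.
  nra.
by rewrite ler_wpM2l// subr_ge0.
Qed.

(** From [1 + 2 * x <= expR (2 * x)] and [(1 + 2 * x) * (1 - x) >= 1], valid up to one half. *)
Lemma expR_le_onem (x : R) : 0 <= x <= 2^-1 -> expR (- (2 * x)) <= 1 - x.
Proof.
move=> /andP[x0 x1]; rewrite expRN invf_ple ?posrE ?expR_gt0//; last by lra.
apply: le_trans (expR_ge1Dx _); rewrite -[X in X <= _]mul1r ler_pdivrMr; nra.
Qed.

End RealBounds.

Section IsolatedCliques.
Variables (R : realType) (V : finType) (c : nat) (g : V -> {set V}).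
Implicit Types (S : {set V}) (s : {ffun V -> {set V}}).

(** The event is phrased as one condition on each vertex, so that its probability is a product over
    the vertices. *)
Definition iso_choice S (v : V) : pred {set V} :=
  fun A => if v \in S then A == (S :\ v)%SET else [disjoint A & S].

Definition isolated_clique S : pred {ffun V -> {set V}} :=
  [pred s : {ffun V -> {set V}} | [forall v, iso_choice S v (s v)]].

Definition selected (s : {ffun V -> {set V}}) : rel V :=
  fun i j => (j \in s i) || (i \in s j).

Definition connectedb (s : {ffun V -> {set V}}) : bool :=
  [forall i, forall j, connect (selected s) i j].

Lemma isolated_clique_closed S s :
  isolated_clique S s -> fingraph.closed (selected s) (mem S).
Proof.
move=> /forallP /= h.
have aux i j : i \in S -> selected s i j -> j \in S.
  have := h i; rewrite /iso_choice => + iS; rewrite iS => /eqP si /orP[].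
    by rewrite si !inE => /andP[].
  have := h j; rewrite /iso_choice; case: ifP => // jS /pred0P/(_ i)/=.
  by rewrite iS andbT => ->.
move=> i j ij; apply/idP/idP => [/aux /(_ ij)//|jS].
by apply: aux jS _; rewrite /selected orbC.
Qed.

Lemma isolated_clique_disconnected S s : (0 < #|S| < #|V|)%N ->
  isolated_clique S s -> ~~ connectedb s.
Proof.
move=> /andP[S0 SV] iS; apply/negP => /forallP/= con.
have [i Si] : exists i, i \in S by apply/card_gt0P.
have [j Sj] : exists j, j \notin S.
  apply/existsP; rewrite -negb_forall; apply: contraL SV => /forallP h.
  rewrite -leqNgt -cardsT; apply/subset_leq_card/fintype.subsetP => x _.
  exact: h.
have := closed_connect (isolated_clique_closed iS) (forallP (con i) j).
by rewrite /= Si (negPf Sj).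
Qed.

(** A common member [v] determines the clique, as [s v] together with [v]. *)
Lemma isolated_clique_eq S1 S2 s v : v \in S1 -> v \in S2 ->
  isolated_clique S1 s -> isolated_clique S2 s -> S1 = S2.
Proof.
move=> v1 v2 /forallP/(_ v) /= + /forallP/(_ v) /=.
rewrite /iso_choice v1 v2 => /eqP e1 /eqP e2.
by rewrite -(finset.setD1K v1) -(finset.setD1K v2) -e1 -e2.
Qed.

Variable (F : {set {set V}}) (e : R).
Hypothesis cdeg : forall v, (c <= #|g v|)%N.
Hypothesis F_card : forall S, S \in F -> #|S| = c.+1.
Hypothesis F_clique : forall S v, S \in F -> v \in S -> S :\ v \subset g v.
Hypothesis e01 : 0 <= e <= 1.
Hypothesis avoid_ge : forall S v, S \in F ->
  1 - e <= vertex_pr R c (g v) [pred A : {set V} | [disjoint A & S]].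

Local Notation p S := (graph_pr R c g (isolated_clique S)).
Local Notation pp S1 S2 :=
  (graph_pr R c g [pred s | isolated_clique S1 s && isolated_clique S2 s]).

Lemma isolated_pr S : p S = \prod_v vertex_pr R c (g v) (iso_choice S v).
Proof. by rewrite -graph_pr_forall. Qed.

(** The two sides are compared vertex by vertex. A vertex of one clique must also avoid the other,
    which costs at least a factor [1 - e] in the product on the right; this happens [2 * c.+1]
    times. At any other vertex the two avoidances are negatively correlated. *)
Lemma isolated_joint_pr S1 S2 : S1 \in F -> S2 \in F -> [disjoint S1 & S2] ->
  (1 - e) ^+ (2 * c.+1) * pp S1 S2 <= p S1 * p S2.
Proof.
move=> F1 F2 d12.
have -> : pp S1 S2 = \prod_v vertex_pr R c (g v)
    (fun A => iso_choice S1 v A && iso_choice S2 v A).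
  rewrite -graph_pr_forall; apply: eq_bigl => s /=.
  apply/andP/forallP => [[/forallP h1 /forallP h2] v|h]; first by rewrite h1 h2.
  by split; apply/forallP => v; have /andP[] := h v.
have -> : (2 * c.+1 = #|S1 :|: S2|)%N.
  rewrite cardsU (F_card F1) (F_card F2).
  by move: d12; rewrite -setI_eq0 => /eqP ->; rewrite cards0; lia.
rewrite -prodr_const big_mkcond/= -big_split/= !isolated_pr -big_split/=.
have e0 : 0 <= 1 - e by move: e01 => /andP[_]; rewrite subr_ge0.
apply: ler_prod => v _; apply/andP; split.
  by rewrite mulr_ge0 ?vertex_pr_ge0//; case: ifP.
rewrite inE; case: (boolP (v \in S1)) => v1 /=.
  have v2 : v \notin S2 by apply: contraTN d12 => v2; apply/pred0Pn; exists v; rewrite /= v1.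
  rewrite mulrC ler_pM ?vertex_pr_ge0//.
    by apply: le_vertex_pr => A _ /andP[].
  apply: le_trans (avoid_ge v F2) _; apply: le_vertex_pr => A _ /=.
  by rewrite /iso_choice (negPf v2).
case: (boolP (v \in S2)) => v2 /=.
  rewrite ler_pM ?vertex_pr_ge0//; last by apply: le_vertex_pr => A _ /andP[].
  apply: le_trans (avoid_ge v F1) _; apply: le_vertex_pr => A _ /=.
  by rewrite /iso_choice (negPf v1).
rewrite mul1r; have := vertex_pr_disjointU R (cdeg v) d12.
rewrite /iso_choice (negPf v1) (negPf v2); apply: le_trans.
apply: le_vertex_pr => A _ /andP[a1 a2] /=.
move: a1 a2; rewrite -!setI_eq0 finset.setIUr => /eqP -> /eqP ->.
by rewrite finset.setU0.
Qed.

(* Second moment method: intersecting cliques exclude each other, and disjoint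
   ones are almost independent by isolated_joint_pr. *)
Lemma no_isolated_clique_pr : 0 < \sum_(S in F) p S -> 0 < 1 - e ->
  graph_pr R c g [pred s | [forall S in F, ~~ isolated_clique S s]] <=
  (\sum_(S in F) p S)^-1 + ((1 - e) ^+ (2 * c.+1))^-1 - 1.
Proof.
set EZ := \sum_(S in F) p S; set th := _ ^+ (2 * _) => EZ0 e1.
have th0 : 0 < th by rewrite exprn_gt0.
pose mu (s : {ffun V -> {set V}}) : R := \prod_v choice_pr R c (g v) (s v).
have mu0 s : 0 <= mu s by apply: prodr_ge0 => v _; exact: choice_pr_ge0.
pose Z s : R := \sum_(S in F) (isolated_clique S s)%:R.
have pE (P : pred {ffun V -> {set V}}) : graph_pr R c g P = \sum_s mu s * (P s)%:R.
  by rewrite /graph_pr big_mkcond; apply: eq_bigr => s _; case: (P s); rewrite ?mulr1 ?mulr0.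
have mu1 : \sum_s mu s = 1 by rewrite -(graph_prT R c g).
have EZE : \sum_s mu s * Z s = EZ.
  under eq_bigr do rewrite mulr_sumr.
  by rewrite exchange_big/=; apply: eq_bigr => S _; rewrite pE.
have EZ2 : \sum_s mu s * Z s ^+ 2 <= EZ + th^-1 * EZ ^+ 2.
  have -> : \sum_s mu s * Z s ^+ 2 = \sum_(S1 in F) \sum_(S2 in F) pp S1 S2.
    under eq_bigr do rewrite expr2 big_distrlr/= mulr_sumr.
    rewrite exchange_big/=; apply: eq_bigr => S1 _.
    under eq_bigr do rewrite mulr_sumr.
    rewrite exchange_big/=; apply: eq_bigr => S2 _; rewrite pE.
    by apply: eq_bigr => s _; rewrite /= -natrM mulnb.
  rewrite expr2 /EZ big_distrlr/= mulr_sumr -big_split/=; apply: ler_sum => S1 F1.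
  rewrite (bigD1 S1)//= lerD//.
    by apply: le_graph_pr => s /= /andP[].
  rewrite mulr_sumr [leRHS](bigD1 S1)//=.
  apply: ler_wpDl.
    by rewrite !mulr_ge0 ?graph_pr_ge0// invr_ge0 ltW.
  apply: ler_sum => S2 /andP[F2 S21].
  case: (boolP [disjoint S1 & S2]) => d12.
    by rewrite ler_pdivlMl//; exact: isolated_joint_pr.
  have [v /andP[/= v1 v2]] := pred0Pn d12.
  rewrite [leLHS](_ : _ = 0) ?mulr_ge0 ?graph_pr_ge0 ?invr_ge0 1?ltW//.
  rewrite /graph_pr big_pred0// => s /=; apply/negP => /andP[i1 i2].
  by move: S21; rewrite (isolated_clique_eq v1 v2 i1 i2) eqxx.
(* Chebyshev's inequality: where no clique is isolated, [Z s = 0] and the squared deviation is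
   [EZ ^+ 2]. *)
have : graph_pr R c g [pred s | [forall S in F, ~~ isolated_clique S s]] * EZ ^+ 2
    <= \sum_s mu s * (Z s - EZ) ^+ 2.
  rewrite pE mulr_suml; apply: ler_sum => s _; rewrite -mulrA ler_wpM2l//=.
  case: (boolP [forall _ in _, _]) => [/forall_inP h|_]; last by rewrite mul0r sqr_ge0.
  rewrite /Z big1 ?sub0r ?sqrrN ?mul1r// => S FS.
  by rewrite (negPf (h S FS)).
have -> : \sum_s mu s * (Z s - EZ) ^+ 2 = \sum_s mu s * Z s ^+ 2 - EZ ^+ 2.
  rewrite (eq_bigr (fun s => mu s * Z s ^+ 2 - 2 * EZ * (mu s * Z s) + EZ ^+ 2 * mu s)).
    rewrite big_split/= sumrB -!mulr_sumr EZE mu1; ring.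
  by move=> s _; ring.
move=> h; have {}h := le_trans h (lerB EZ2 (lexx _)).
have E2 : 0 < EZ ^+ 2 by rewrite exprn_gt0.
rewrite -(ler_pM2r E2); apply: le_trans h _.
by rewrite mulrBl mulrDl mul1r [EZ^-1 * _]mulrC expr2 mulfK ?gt_eqF// -expr2.
Qed.

(** A member of [S] makes its prescribed choice with probability at least [D ^- c]. Only the at most
    [c.+1 * D] neighbours of members can select one; every other vertex avoids [S] automatically. *)
Lemma isolated_pr_ge D S : S \in F -> (forall v, (#|g v| <= D)%N) ->
  (forall u v, (u \in g v) = (v \in g u)) ->
  (D%:R ^+ (c * c.+1))^-1 * (1 - e) ^+ (c.+1 * D) <= p S.
Proof.
move=> FS gD gsym.
have e1 : 0 <= 1 - e <= 1 by move: e01 => /andP[? ?]; rewrite subr_ge0 lerBlDr lerDl; apply/andP.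
pose N := (\bigcup_(v in S) g v)%SET.
have NS : (#|N| <= c.+1 * D)%N.
  rewrite -(F_card FS) -sum_nat_const /N.
  apply: (big_ind2 (fun (A : {set V}) n => #|A| <= n)%N) => [|A1 n1 A2 n2 h1 h2|v _].
  - by rewrite cards0.
  - by rewrite (leq_trans (leq_card_setU _ _))// leq_add.
  - exact: gD.
rewrite isolated_pr (bigID (mem S))/= ler_pM ?exprn_ge0 ?invr_ge0//.
- by case/andP: e1.
- rewrite exprM -exprVn -(F_card FS) -prodr_const -natrX.
  apply: ler_prod => v vS; rewrite invr_ge0 ler0n /=.
  rewrite (_ : vertex_pr _ _ _ _ = 'C(#|g v|, c)%:R^-1).
    rewrite lef_pV2 ?posrE ?ltr0n ?bin_gt0//; last first.
      by rewrite expn_gt0; case: (posnP D) => // D0; have := gD v; have := cdeg v; rewrite D0; lia.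
    rewrite ler_nat (@leq_trans (#|g v| ^ c)%N)//.
      by rewrite (leq_trans _ (ffact_leX _ _))// -bin_ffact leq_pmulr// fact_gt0.
    by case: (posnP c) => [->|c0]; rewrite ?expn0 ?leq_exp2r ?gD.
  rewrite -(vertex_pr1 R (cdeg v) (F_clique FS vS)).
    by apply: eq_bigl => A; rewrite /iso_choice vS.
  by have := cardsD1 v S; rewrite vS (F_card FS); lia.
- apply: (@le_trans _ _ ((1 - e) ^+ #|N|)).
    by case/andP: e1 => ? ?; rewrite ler_wiXn2l.
  rewrite -prodr_const big_mkcond [leRHS]big_mkcond/=.
  apply: ler_prod => v _; apply/andP; split; first by case: ifP => // _; case/andP: e1.
  case: (boolP (v \in S)) => /= vS.
    by case: ifP => // _; case/andP: e1.
  have E : vertex_pr R c (g v) [pred A : {set V} | [disjoint A & S]] <=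
      vertex_pr R c (g v) (iso_choice S v).
    by apply: le_vertex_pr => A _ /=; rewrite /iso_choice (negPf vS).
  case: ifP => vN; first exact: le_trans (avoid_ge v FS) E.
  apply: le_trans E; rewrite -(vertex_prT R c (g v)); apply: le_vertex_pr => A.
  rewrite finset.in_set => /andP[Ag _] _ /=; apply/pred0P => u /=; apply/negP => /andP[uA uS].
  move/negP: vN; apply; apply/bigcupP; exists u => //.
  by rewrite gsym (fintype.subsetP Ag).
Qed.

End IsolatedCliques.

Section LocalCliques.
Variables (R : realType) (d m kappa : nat) (V : finType) (lam : R).
Variables (g : V -> {set V}) (cell : V -> {ffun 'I_d -> 'I_m}).
Hypothesis Hc : cellular kappa lam g cell.

Definition block_subsets (k : nat) : {set {set V}} :=
  [set S : {set V} | (#|S| == k) && [exists q, S \subset block cell q]]%SET.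

Lemma block_subset_clique k S v : S \in block_subsets k -> v \in S -> (S :\ v)%SET \subset g v.
Proof.
rewrite finset.in_set => /andP[_ /existsP[q /fintype.subsetP Sq]] vS.
apply/fintype.subsetP => u /finset.setD1P[uv uS]; apply: (nbr_adj Hc) => //.
have := Sq _ uS; have := Sq _ vS; rewrite !finset.in_set => /eqP -> /eqP ->.
by apply/forallP => i; rewrite !leqnSn.
Qed.

(** A nonempty set lies in at most one cell, so the sum over cells counts no set twice; this is why
    the size is a successor. *)
Lemma card_block_subsets k :
  (\sum_q 'C(#|block cell q|, k.+1) <= #|block_subsets k.+1|)%N.
Proof.
under eq_bigr do rewrite -cards_draws -sum1_card big_mkcond.
rewrite exchange_big/= -sum1_card [leqRHS]big_mkcond/=; apply: leq_sum => S _.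
case: ifP => [|/negbT Sk].
  rewrite finset.in_set => /andP[/eqP cS /existsP[q Sq]].
  rewrite (bigD1 q)//= finset.in_set Sq cS eqxx/= big1// => q' q'q.
  rewrite finset.in_set; case: (boolP (S \subset _)) => //= Sq'.
  have [v vS] : exists v, v \in S by apply/card_gt0P; rewrite cS.
  have := fintype.subsetP Sq' _ vS; have := fintype.subsetP Sq _ vS.
  by rewrite !finset.in_set => /eqP vq /eqP vq'; rewrite -vq -vq' eqxx in q'q.
rewrite big1// => q _; rewrite finset.in_set; case: (boolP (S \subset _)) => //= Sq.
case: (boolP (_ == _)) => //= cS; move/negP: Sk; case.
by rewrite finset.in_set cS/=; apply/existsP; exists q.
Qed.

Lemma bin_ge (n k : nat) : (0 < k)%N -> (k.-1 <= n)%N ->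
  (n%:R - k.-1%:R) ^+ k / k`!%:R <= 'C(n, k)%:R :> R.
Proof.
case: k => // k _ /= kn; rewrite ler_pdivrMr ?ltr0n ?fact_gt0// -natrB// -natrX -natrM ler_nat.
rewrite bin_ffact ffactnSr expnSr leq_mul//; exact: subn_expn_le_ffact.
Qed.

Lemma card_block_subsets_ge k : 8 * k%:R <= lam ->
  #|{: {ffun 'I_d -> 'I_m}}|%:R * ((lam / 8) ^+ k.+1 / k.+1`!%:R) <= #|block_subsets k.+1|%:R.
Proof.
move=> hk; apply: (@le_trans _ _ (\sum_q 'C(#|block cell q|, k.+1))%N%:R); last first.
  by rewrite ler_nat card_block_subsets.
rewrite natr_sum mulr_natl -cardsT -sumr_const [leRHS](eq_bigl (mem [set: {ffun 'I_d -> 'I_m}]%SET)); last first.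
  by move=> q; rewrite /= finset.in_setT.
apply: ler_sum => q _.
have hb := cell_card_ge Hc q; rewrite -blockE in hb.
have k0 : 0 <= k%:R :> R by [].
apply: (le_trans _ (bin_ge _ _)) => //=; last by rewrite -(ler_nat R); lra.
rewrite ler_pM2r ?invr_gt0 ?ltr0n ?fact_gt0//.
by rewrite lerXn2r ?nnegrE; lra.
Qed.

End LocalCliques.

(** * Disconnection below the threshold *)

Section DisconnectedRegime.
Variables (R : realType) (d kappa c : nat).
Local Notation K := ((4 * kappa + 1) ^ d)%N.

(** The second moment bound is applied to all sets of [c.+1] points inside one cell. It suffices
    that their expected number of isolated ones is large and that the probability [e] of not
    avoiding such a set is small. *)
Lemma cellular_disconnected (eps : R) : 0 < eps -> exists lam0 tau : R, 
  forall (m : nat) (V : finType) (lam : R) (g : V -> {set V}) (cell : V -> {ffun 'I_d -> 'I_m}),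
  cellular kappa lam g cell -> lam0 <= lam -> tau * lam ^+ (c ^ 2) <= #|V|%:R ->
  graph_pr R c g [pred s | connectedb s] <= eps.
Proof.
move=> eps0.
(* A choice meets a given set with probability at most [8 * B0 / lam], since [c * (c.+1 + c)] is
   [B0]. The larger [B] also dominates [c.+1 * B0] and the degree requirement [2 * c + 1]. *)
pose B0 : R := (c * (2 * c + 1))%:R; pose B : R := (c.+1 * c.+1 * (2 * c + 1))%:R.
have B0_ge0 : 0 <= B0 by [].
have B_ge1 : 1 <= B by rewrite /B ler1n; clear; lia.
have B0c : c.+1%:R * B0 <= B by rewrite /B0 /B -natrM ler_nat; clear; nia.
have cB : 2 * c%:R + 1 <= B by rewrite /B -natrM natr1 ler_nat; clear; nia.
have B0_ge n : (n <= 2 * c + 1)%N -> (c * n)%:R <= B0 by move=> h; rewrite /B0 ler_nat leq_mul.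
clearbody B B0.
(* [k0] bounds the probability that all neighbours avoid the clique, because [e] times the maximal
   degree is at most [8 * B0 * (4 * K)]. [C1] collects the constants of the expected number of
   isolated cliques. *)
pose k0 : R := expR (- (16 * B0 * c.+1%:R * (4 * K%:R))).
pose C1 : R := k0 / (c.+1`!%:R * 8 ^+ c.+1 * (4 * K%:R) ^+ (c * c.+1)).
have K0 : 0 < K%:R :> R by rewrite ltr0n expn_gt0; lia.
have K1 : 1 <= K%:R :> R by rewrite ler1n -(ltr0n R).
have C10 : 0 < C1.
  by rewrite divr_gt0 ?expR_gt0// !mulr_gt0 ?exprn_gt0 ?ltr0n ?fact_gt0 ?mulr_gt0.
(* The first bound gives [c.+1 * e <= eps / 8], so the correlation term costs at most [eps / 2]; the
   second makes the expectation at least [2 / eps]. *)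
exists (64 * B * (1 + eps^-1)), (8 / (C1 * eps)) => m V lam g cell Hc hlam hn.
have ie0 : 0 < eps^-1 by rewrite invr_gt0.
have lam64 : 64 * B <= lam by apply: le_trans hlam; rewrite ler_peMr; lra.
have lam_eps : 64 * B <= lam * eps.
  rewrite -ler_pdivrMr//; apply: le_trans hlam; rewrite ler_wpM2l; lra.
have lam0 : 0 < lam by lra.
pose e : R := 8 * B0 / lam.
have c0 : 0 <= c%:R :> R by [].
have deg v : (2 * c + 1 <= #|g v|)%N.
  have := deg_ge Hc v; rewrite -(ler_nat R) natrD natrM => h.
  apply: le_trans (h _); lra.
have degR v : lam / 8 <= #|g v|%:R by apply: (deg_ge Hc); lra.
have B0e : c.+1%:R * e <= 8 * B / lam.
  by rewrite /e mulrA ler_pM2r ?invr_gt0// mulrCA ler_pM2l.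
have e0 : 0 <= e by rewrite /e divr_ge0 ?mulr_ge0// ltW.
have ce8 : c.+1%:R * e <= 8^-1.
  by apply: le_trans B0e _; rewrite ler_pdivrMr//; lra.
have e8 : e <= 8^-1 by apply: le_trans ce8; rewrite ler_peMl// ler1n.
have e01 : 0 <= e <= 1 by apply/andP; split; lra.
pose F := block_subsets cell c.+1.
have F_card S : S \in F -> #|S| = c.+1 by rewrite finset.in_set => /andP[/eqP].
have avoid S v : S \in F ->
    1 - e <= vertex_pr R c (g v) [pred A : {set V} | [disjoint A & S]].
  move=> FS; have gS : (#|g v :&: S| + c <= 2 * c + 1)%N.
    have : (#|g v :&: S| <= c.+1)%N.
      by rewrite -(F_card _ FS) subset_leq_card// finset.subsetIr.
    by move=> h; clear -h; lia.
  have dv := deg v; have dv0 : (0 < #|g v|)%N by clear -dv; lia.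
  have dv0R : 0 < #|g v|%:R :> R by rewrite ltr0n.
  apply: le_trans (vertex_pr_disjoint_ge R _ _ _) => //; try by clear -dv gS; lia.
  apply: le_trans (bernoulli_le _ _); last first.
    by rewrite divr_ge0//= ler_pdivrMr// mul1r ler_nat; clear -dv gS; lia.
  rewrite lerD2l lerN2 mulrA -natrM ler_pdivrMr// /e mulrAC ler_pdivlMr// mulrAC.
  rewrite -ler_pdivlMr//.
  have h1 : (c * (#|g v :&: S| + c))%:R <= B0 by exact: B0_ge.
  have h2 := degR v.
  apply: (le_trans h1); rewrite ler_pdivlMr//.
  have := ler_wpM2l B0_ge0 h2; lra.
pose D := Num.truncn (K%:R * (4 * lam)).
have KL : 1 <= K%:R * (4 * lam) by have := ler_pM ler01 ler01 K1 (_ : 1 <= 4 * lam); rewrite mul1r; apply; lra.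
have gD v : (#|g v| <= D)%N.
  by rewrite truncn_ge_nat ?(deg_le Hc)// (le_trans _ KL).
have DR : D%:R <= K%:R * (4 * lam) by rewrite truncn_le (le_trans _ KL).
have D0 : 0 < D%:R :> R by rewrite ltr0n truncn_gt0.
have pS S : S \in F ->
    ((K%:R * (4 * lam)) ^+ (c * c.+1))^-1 * k0 <= graph_pr R c g (isolated_clique S).
  move=> FS.
  apply: le_trans (isolated_pr_ge _ F_card _ e01 avoid FS gD (nbr_sym Hc)).
  - rewrite ler_pM ?invr_ge0 ?exprn_ge0 ?expR_ge0//; first by lra.
      by rewrite lef_pV2 ?posrE ?exprn_gt0//; [rewrite lerXn2r ?nnegrE//; clear -DR KL; lra|clear -KL; lra].
    apply: (@le_trans _ _ (expR (- (2 * e)) ^+ (c.+1 * D))).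
      rewrite -expRM_natl ler_expR mulrN lerN2 natrM.
      have : e * D%:R <= 8 * B0 * (4 * K%:R).
        apply: le_trans (ler_wpM2l e0 DR) _.
        rewrite /e mulrAC ler_pdivrMr//; have : 0 <= K%:R by []; lra.
      have cc0 : 0 <= c.+1%:R :> R by [].
      by move=> /(ler_wpM2l cc0) h; clear -h; lra.
    by rewrite lerXn2r ?nnegrE ?expR_ge0//; [lra|apply: expR_le_onem; lra].
  - by move=> v; have dv := deg v; clear -dv; lia.
  - by move=> S' v; exact: (@block_subset_clique _ _ _ _ _ _ _ _ Hc c.+1 S' v).
have EZ : C1 * (#|{: {ffun 'I_d -> 'I_m}}|%:R * lam) / lam ^+ (c ^ 2) <=
    \sum_(S in F) graph_pr R c g (isolated_clique S).
  apply: (@le_trans _ _ (\sum_(S in F) ((K%:R * (4 * lam)) ^+ (c * c.+1))^-1 * k0)); last exact: ler_sum.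
  rewrite sumr_const -[leRHS]mulr_natl.
  have := card_block_subsets_ge Hc (_ : 8 * c%:R <= lam).
  rewrite -/F => /(_ ltac:(lra)) hF.
  apply: le_trans (ler_wpM2r _ hF); last first.
    by rewrite mulr_ge0 ?invr_ge0 ?exprn_ge0 ?expR_ge0//; lra.
  rewrite /C1 le_eqVlt; apply/orP; left; apply/eqP.
  (* A cell offers of order [lam ^+ c.+1] sets, each isolated with probability of order
     [lam ^- (c * c.+1)]; the product is [lam / lam ^+ (c ^ 2)]. *)
  have -> : (c * c.+1 = c ^ 2 + c)%N by clear; lia.
  rewrite !exprMn !exprD !exprS !exprVn; field.
  by rewrite !expf_neq0 ?(gt_eqF lam0) ?(gt_eqF K0) ?pnatr_eq0 -?lt0n ?fact_gt0.
have EZn : 2 / eps <= \sum_(S in F) graph_pr R c g (isolated_clique S).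
  apply: le_trans EZ; rewrite ler_pdivlMr ?exprn_gt0//.
  have h := le_trans hn (cells_ge Hc).
  have : C1 * (8 / (C1 * eps) * lam ^+ (c ^ 2)) = 4 * (2 / eps * lam ^+ (c ^ 2)).
    by field; rewrite !gt_eqF.
  have := ler_wpM2l (ltW C10) h; lra.
have EZ0 : 0 < \sum_(S in F) graph_pr R c g (isolated_clique S).
  by apply: lt_le_trans EZn; rewrite divr_gt0.
have cdeg v : (c <= #|g v|)%N by have dv := deg v; clear -dv; lia.
have e1 : 0 < 1 - e by lra.
have no_iso := no_isolated_clique_pr cdeg F_card e01 avoid EZ0 e1.
apply: (@le_trans _ _ (graph_pr R c g [pred s | [forall S in F, ~~ isolated_clique S s]])).
  apply: le_graph_pr => s /= con; apply/forall_inP => S FS; apply: contraTN con.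
  apply: isolated_clique_disconnected; rewrite (F_card _ FS)/=.
  have [v vS] : exists v, v \in S by apply/card_gt0P; rewrite (F_card _ FS).
  apply: leq_trans (_ : #|g v| < _)%N; last first.
    rewrite -cardsT proper_card// properT; apply/eqP => gT.
    by have := nbr_irrefl Hc v; rewrite gT finset.in_setT.
  by have dv := deg v; clear -dv; lia.
apply: (le_trans no_iso).
have h1 : (\sum_(S in F) graph_pr R c g (isolated_clique S))^-1 <= eps / 2.
  by rewrite -[leRHS]invrK invf_div lef_pV2 ?posrE ?divr_gt0.
have h2 : ((1 - e) ^+ (2 * c.+1))^-1 - 1 <= eps / 2.
  have hb := bernoulli_le (2 * c.+1) e01.
  set z := c.+1%:R * e in ce8 B0e *.
  have z0 : 0 <= z by rewrite mulr_ge0.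
  have zeps : z <= eps / 8.
    rewrite -(ler_pM2r lam0); move: B0e; rewrite ler_pdivlMr// => h.
    by clear -h lam_eps; lra.
  have hp : 1 - 2 * z <= (1 - e) ^+ (2 * c.+1) by move: hb; rewrite natrM -mulrA.
  clear -hp z0 zeps ce8.
  rewrite lerBlDr invf_ple ?posrE; [|by apply: lt_le_trans hp; lra|lra].
  apply: le_trans hp; rewrite -[leLHS]mul1r ler_pdivrMr; [nra|lra].
clear -h1 h2 eps0; lra.
Qed.

End DisconnectedRegime.

(** * Subset counts and exponential decay *)

Section Counting.
Variable R : realType.

Lemma sum_subsets (V : finType) (G : {set V}) (a b : R) :
  \sum_(U : {set V} | U \subset G) a ^+ #|U| * b ^+ (#|G| - #|U|) = (a + b) ^+ #|G|.
Proof.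
rewrite addrC exprDn.
rewrite (partition_big (fun U : {set V} => inord #|U| : 'I_(#|G|.+1)) xpredT)//=.
apply: eq_bigr => i _.
rewrite (eq_bigl (mem [set U : {set V} | U \subset G & #|U| == i]%SET)); last first.
  move=> U; rewrite /= finset.in_set; case: (boolP (U \subset G)) => //= UG.
  by rewrite -val_eqE/= inordK// ltnS subset_leq_card.
rewrite (eq_bigr (fun=> b ^+ (#|G| - i) * a ^+ i)).
  by rewrite sumr_const cards_draws.
by move=> U /=; rewrite finset.in_set => /andP[_ /eqP ->]; rewrite mulrC.
Qed.

(** Each subset counted satisfies [1 <= x ^- j * x ^+ #|U|], and summing this weight over all
    subsets of [G] gives [x ^- j * (1 + x) ^+ #|G|]. *)
Lemma card_small_subsets (V : finType) (G : {set V}) (x : R) (j : nat) : 0 < x <= 1 ->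
  #|[set U : {set V} | U \subset G & (#|U| <= j)%N]%SET|%:R <= x ^- j * expR (x * #|G|%:R).
Proof.
move=> /andP[x0 x1]; apply: (@le_trans _ _ (x ^- j * (x + 1) ^+ #|G|)); last first.
  rewrite ler_pM2l ?invr_gt0 ?exprn_gt0// [x * _]mulrC expRM_natl.
  by rewrite lerXn2r ?nnegrE ?expR_ge0 ?addr_ge0 ?(ltW x0)// addrC expR_ge1Dx.
rewrite -sum_subsets mulr_sumr -sumr_const big_mkcond [leRHS]big_mkcond/=.
apply: ler_sum => U _; rewrite finset.in_set; case: (boolP (U \subset G)) => //= UG.
rewrite expr1n mulr1; case: ifP => jU; last by rewrite mulr_ge0 ?invr_ge0 ?exprn_ge0 ?ltW.
by rewrite mulrC ler_pdivlMr ?exprn_gt0// mul1r ler_wiXn2l// ltW.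
Qed.

Lemma card_subsets_le (V : finType) (G : {set V}) (k : nat) :
  (#|[set U : {set V} | U \subset G & #|U| == k]%SET| <= #|G| ^ k)%N.
Proof.
rewrite cards_draws; apply: leq_trans (ffact_leX _ _).
by rewrite -bin_ffact leq_pmulr// fact_gt0.
Qed.

(** Writing [expR x] as the power [k.+1] of [expR (x / k.+1)] shows that it is at least
    [x ^+ k.+1 / C], so the product is at most [C / x]. *)
Lemma exprMexpRN_small (k : nat) (eps : R) : 0 < eps ->
  exists x0 : R, 0 < x0 /\ forall x, x0 <= x -> x ^+ k * expR (- x) <= eps.
Proof.
move=> eps0; pose C : R := k.+1%:R ^+ k.+1.
have C0 : 0 < C by rewrite exprn_gt0.
exists (C / eps); split=> [|x hx]; first by rewrite divr_gt0.
have x0 : 0 < x by apply: lt_le_trans hx; rewrite divr_gt0.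
rewrite expRN ler_pdivrMr ?expR_gt0//.
have -> : expR x = expR (x / k.+1%:R) ^+ k.+1.
  by rewrite -expRM_natl mulrCA divff ?mulr1.
have h : (x / k.+1%:R) ^+ k.+1 <= expR (x / k.+1%:R) ^+ k.+1.
  rewrite lerXn2r ?nnegrE ?expR_ge0 ?divr_ge0 ?(ltW x0)//.
  by apply: le_trans (expR_ge1Dx _); rewrite lerDr.
rewrite -ler_pdivrMl//; apply: le_trans h.
rewrite mulrC expr_div_n -/C exprS ler_pdivlMr// -mulrA mulrC -mulrA.
by rewrite mulrA ler_pM2r ?exprn_gt0// mulrC.
Qed.

End Counting.

(** * Closed sets are sparse or dense everywhere *)

Section Mixing.
Variables (R : realType) (d m kappa c : nat) (V : finType) (lam eta : R).
Variables (g : V -> {set V}) (cell : V -> {ffun 'I_d -> 'I_m}).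
Hypothesis Hc : cellular kappa lam g cell.
Hypothesis lam8 : 8 <= lam.
Hypothesis cdeg : forall v, (c <= #|g v|)%N.
Local Notation K := ((4 * kappa + 1) ^ d)%N.
Local Notation cells := {ffun 'I_d -> 'I_m}.
Implicit Types (p q : cells) (T S : {set V}) (s : {ffun V -> {set V}}).

Definition unmixed (x : cells * cells * {set V}) : bool :=
  let Q := (block cell x.1.1 :|: block cell x.1.2)%SET in
  [&& cell_adj x.1.1 x.1.2, x.2 \subset Q, eta * lam <= #|x.2|%:R
    & eta * lam <= #|(Q :\: x.2)%SET|%:R].

(** Only the choices made by [x.2] are constrained: this half of closedness suffices and is a
    product event over [x.2]. *)
Definition split_by s (x : cells * cells * {set V}) : bool :=
  let Q := (block cell x.1.1 :|: block cell x.1.2)%SET in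
  [forall v in x.2, [disjoint s v & (Q :\: x.2)%SET]].

Lemma adj_blocks_clique p q u v : cell_adj p q ->
  u \in (block cell p :|: block cell q)%SET -> v \in (block cell p :|: block cell q)%SET ->
  u != v -> u \in g v.
Proof.
move=> /forallP pq; rewrite !finset.inE => hu hv uv; apply: (nbr_adj Hc) => //.
apply/forallP => k; have := pq k.
by case/orP: hu => /eqP ->; case/orP: hv => /eqP ->; rewrite ?leqnSn// => /andP[-> ->].
Qed.

Lemma deg_gt0 v : (0 < #|g v|)%N.
Proof.
rewrite -(ltr0n R); apply: lt_le_trans (deg_ge Hc v lam8).
by rewrite divr_gt0//; apply: lt_le_trans lam8.
Qed.

(** Every vertex of [T] sees all of [Q :\: T], which gives an exponent of order
    [c * #|T| * #|Q :\: T| / lam]. One of the two parts has at least [lam / 8] points and the other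
    at least [eta * lam]. *)
Lemma split_pr_le x : 0 < eta -> unmixed x ->
  graph_pr R c g (split_by^~ x) <= expR (- (c%:R * eta * lam / (32 * K%:R))).
Proof.
case: x => -[p q] T eta0; rewrite /unmixed /split_by /=; set Q := (block cell p :|: _)%SET.
move=> /and4P[pq TQ T_ge QT_ge].
have K0 : 0 < K%:R :> R by rewrite ltr0n expn_gt0; clear; lia.
have l0 : 0 < lam by exact: lt_le_trans lam8.
pose a : R := expR (- (c%:R * #|(Q :\: T)%SET|%:R / (4 * K%:R * lam))).
apply: (@le_trans _ _ (a ^+ #|T|)).
  apply: (@graph_pr_forall_in_le R V c g T (fun v A => [disjoint A & (Q :\: T)%SET])) => v vT.
  apply: le_trans (vertex_pr_disjoint_le R (Q :\: T)%SET (cdeg v) (deg_gt0 v)) _.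
  rewrite ler_expR lerN2.
  have -> : (g v :&: (Q :\: T) = Q :\: T)%SET.
    apply/finset.setIidPr/fintype.subsetP => u; rewrite finset.in_setD => /andP[uT uQ].
    apply: (adj_blocks_clique pq) => //; first exact: (fintype.subsetP TQ).
    by apply: contraNneq uT => ->.
  rewrite ler_wpM2l ?mulr_ge0// lef_pV2 ?posrE ?ltr0n ?deg_gt0 ?mulr_gt0//.
  by have := deg_le Hc v; lra.
rewrite -expRM_natl ler_expR mulrN lerN2.
set y : R := #|(Q :\: T)%SET|%:R; set t : R := #|T|%:R; rewrite -/y in QT_ge; rewrite -/t in T_ge.
have yt : lam / 4 <= y + t.
  have := cell_card_ge Hc p; rewrite -blockE.
  have : (#|block cell p| <= #|(Q :\: T)%SET| + #|T|)%N.
    apply: (@leq_trans #|Q|); first by rewrite subset_leq_card// finset.subsetUl.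
    by rewrite -(cardsID T Q) addnC leq_add2l subset_leq_card// finset.subsetIr.
  by rewrite -(ler_nat R) natrD -/y -/t; lra.
have tl : eta * lam * lam <= 8 * (y * t).
  have el : 0 < eta * lam by rewrite mulr_gt0.
  have [h|h] := leP (lam / 8) t.
    have := ler_pM (ltW el) (_ : 0 <= lam / 8) QT_ge h.
    by move=> /(_ _); lra.
  have h' : lam / 8 <= y by lra.
  have := ler_pM (ltW el) (_ : 0 <= lam / 8) T_ge h'.
  by move=> /(_ _); lra.
have -> : t * (c%:R * y / (4 * K%:R * lam)) = c%:R * (y * t) / (4 * K%:R * lam) by ring.
rewrite ler_pdivrMr ?mulr_gt0// [leRHS]mulrAC ler_pdivlMr ?mulr_gt0//.
have c0 : 0 <= c%:R * (4 * K%:R) :> R by rewrite !mulr_ge0.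
have := ler_wpM2l c0 tl; lra.
Qed.

(** A union bound over pairs of cells and at most [expR (8 * lam)] subsets of their union. Since 288
    is 9 times 32, each term is at most [expR (- (9 * lam))]. *)
Lemma mixing_pr : 0 < eta -> 288 * K%:R <= c%:R * eta ->
  graph_pr R c g [pred s | [exists x, unmixed x && split_by s x]] <=
  #|{: cells}|%:R ^+ 2 * expR (- lam).
Proof.
move=> eta0 hc.
have K0 : 0 < K%:R :> R by rewrite ltr0n expn_gt0; clear; lia.
apply: le_trans (@graph_pr_union R V c g _ unmixed _ (fun x s => split_by s x) _) _.
  by move=> s _ /existsP[x /andP[ux sx]]; exists x.
apply: (@le_trans _ _ (\sum_(x | unmixed x) expR (- (9 * lam)))).
  apply: ler_sum => x ux; apply: (le_trans (split_pr_le eta0 ux)).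
  rewrite ler_expR lerN2 ler_pdivlMr ?mulr_gt0//.
  by have := ler_wpM2r (ltW (lt_le_trans (ltr0n _ 8) lam8)) hc; lra.
have -> : expR (- lam) = expR (8 * lam) * expR (- (9 * lam)) by rewrite -expRD; congr expR; ring.
apply: (@le_trans _ _ (\sum_(pq : cells * cells) expR (8 * lam) * expR (- (9 * lam)))); last first.
  by rewrite sumr_const card_prod -[leLHS]mulr_natl natrM expr2 lexx.
rewrite big_mkcond/= -(pair_bigA _ (fun pq T => if unmixed (pq, T) then expR (- (9 * lam)) else 0))/=.
apply: ler_sum => -[p q] _; set Q := (block cell p :|: block cell q)%SET.
apply: (@le_trans _ _ (\sum_(T in powerset Q) expR (- (9 * lam)))).
  rewrite [leRHS]big_mkcond/=; apply: ler_sum => T _.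
  case: ifP => [/and4P[_ TQ _ _]|_]; first by rewrite finset.powersetE TQ.
  by case: ifP; rewrite ?expR_ge0.
rewrite sumr_const -[leLHS]mulr_natl ler_pM2r ?expR_gt0// finset.card_powerset natrX.
have Q8 : #|Q|%:R <= 8 * lam.
  have := cell_card_le Hc p; have := cell_card_le Hc q; rewrite -!blockE.
  have : (#|Q| <= #|block cell p| + #|block cell q|)%N by rewrite leq_card_setU.
  by rewrite -(ler_nat R) natrD; lra.
apply: (@le_trans _ _ (expR 1 ^+ #|Q|)).
  by rewrite lerXn2r ?nnegrE ?expR_ge0// (le_trans _ (expR_ge1Dx _)).
by rewrite -expRM_natl mulr1 ler_expR.
Qed.

(* Two adjacent cells form a clique, so a closed set with an intermediate
   density in their union would split that clique. *)
Lemma closed_sparse_or_dense s S : eta < 8^-1 ->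
  (forall x, unmixed x -> ~~ split_by s x) -> fingraph.closed (selected s) (mem S) ->
  (forall q, #|S :&: block cell q|%:R < eta * lam) \/
  (forall q, #|block cell q :\: S|%:R < eta * lam).
Proof.
move=> eta8 mix cS.
have pair p q : cell_adj p q ->
    #|S :&: (block cell p :|: block cell q)|%:R < eta * lam \/
    #|(block cell p :|: block cell q) :\: S|%:R < eta * lam.
  move=> pq; set Q := (block cell p :|: _)%SET.
  case: (ltP #|S :&: Q|%:R (eta * lam)) => h1; [by left|right].
  rewrite ltNge; apply/negP => h2.
  have QS : (Q :\: (S :&: Q) = Q :\: S)%SET.
    by apply/setP => v; rewrite !finset.inE; case: (v \in S); case: (_ || _).
  have ux : unmixed (p, q, (S :&: Q)%SET).
    by rewrite /unmixed/= pq finset.subsetIr h1 -/Q QS h2.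
  move: (mix _ ux) => /negP; apply; apply/forall_inP => v /= vSQ.
  rewrite -/Q QS; apply/pred0P => u /=; apply/negP => /andP[uv].
  rewrite finset.in_setD => /andP[/negP uS _]; apply: uS.
  have := cS v u; rewrite /selected uv => /(_ isT) <-.
  by move: vSQ; rewrite finset.in_setI => /andP[].
(* Were the union of both cells dense in [S], then cell [p] would have fewer than
   [2 * eta * lam < lam / 4] points. *)
have spread p q : cell_adj p q -> #|S :&: block cell p|%:R < eta * lam ->
    #|S :&: block cell q|%:R < eta * lam.
  move=> pq Sp; have l0 : 0 < lam by exact: lt_le_trans lam8.
  case: (pair p q pq) => h.
    by apply: le_lt_trans h; rewrite ler_nat subset_leq_card// finset.setIS// finset.subsetUr.
  exfalso; have := cell_card_ge Hc p; rewrite -blockE.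
  have : (#|block cell p| <= #|S :&: block cell p| + #|(block cell p :|: block cell q) :\: S|)%N.
    rewrite -(cardsID S (block cell p)) finset.setIC leq_add2l subset_leq_card//.
    by rewrite finset.setSD// finset.subsetUl.
  rewrite -(ler_nat R) natrD => h3 h4.
  have : eta * lam < 8^-1 * lam by rewrite ltr_pM2r.
  by lra.
have [/existsP[p Sp]|/existsPn none] :=
  boolP [exists p, #|S :&: block cell p|%:R < eta * lam].
  left=> q; apply: (@cell_adj_connected d m (fun q => #|S :&: block cell q|%:R < eta * lam) _ p q) => //.
right=> q; case: (pair q q).
- by apply/forallP => k; rewrite leqnSn.
- by rewrite finset.setUid => h; have := none q; rewrite h.
- by rewrite finset.setUid.
Qed.

(** A component and its complement are both closed and nonempty; if the component is not sparse
    everywhere, its complement is. *)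
Lemma disconnected_sparse s : eta < 8^-1 ->
  (forall x, unmixed x -> ~~ split_by s x) -> ~~ connectedb s ->
  exists S, [/\ fingraph.closed (selected s) (mem S), S != finset.set0 &
    forall q, #|S :&: block cell q|%:R < eta * lam].
Proof.
move=> eta8 mix /forallPn[i /forallPn[j ij]].
have sym : connect_sym (selected s) by apply: sym_connect_sym => u v; rewrite /selected orbC.
pose S := [set v | connect (selected s) i v]%SET.
have cS : fingraph.closed (selected s) (mem S).
  move=> u v uv; rewrite !finset.in_set.
  by apply/idP/idP => h; apply: connect_trans h _; [|rewrite sym]; exact: connect1.
case: (closed_sparse_or_dense eta8 mix cS) => h.
  by exists S; split=> //; apply/set0Pn; exists i; rewrite finset.in_set connect0.
exists (~: S)%SET; split.
- by move=> u v uv; have := cS u v uv; rewrite !finset.in_setC => ->.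
- by apply/set0Pn; exists j; rewrite finset.in_setC finset.in_set.
- by move=> q; rewrite finset.setIC -finset.setDE.
Qed.

End Mixing.

(** * Sparse closed sets *)

Section SparseClosedSets.
Variables (R : realType) (d m kappa c : nat) (V : finType) (lam : R).
Variables (g : V -> {set V}) (cell : V -> {ffun 'I_d -> 'I_m}).
Hypothesis Hc : cellular kappa lam g cell.
Hypothesis lam8 : 8 <= lam.
Hypothesis cdeg : forall v, (c <= #|g v|)%N.
Local Notation K := ((4 * kappa + 1) ^ d)%N.
Local Notation cells := {ffun 'I_d -> 'I_m}.
Implicit Types (p q : cells) (S W U : {set V}) (s : {ffun V -> {set V}}).

Definition picks_in W U : pred {ffun V -> {set V}} :=
  [pred s : {ffun V -> {set V}} | [forall v in W, s v \subset U]].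

(** A vertex has degree at least [lam / 8], so each of the [c * #|W|] selections contributes a
    factor at most [8 * #|U| / lam]. *)
Lemma picks_in_pr_le W U (a : R) : 8 * #|U|%:R / lam <= a ->
  graph_pr R c g (picks_in W U) <= a ^+ (c * #|W|).
Proof.
move=> Ua; rewrite exprM.
have l0 : 0 < lam by exact: lt_le_trans lam8.
apply: (@graph_pr_forall_in_le R V c g W (fun v A => A \subset U)) => v vW.
apply: le_trans (vertex_pr_sub_le R U (cdeg v) (deg_gt0 Hc lam8 v)) _.
rewrite lerXn2r ?nnegrE ?divr_ge0//; first by apply: le_trans Ua; rewrite divr_ge0 ?mulr_ge0// ltW.
apply: le_trans Ua; rewrite ler_pdivrMr ?ltr0n ?(deg_gt0 Hc)//.
rewrite mulrAC ler_pdivlMr//.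
have h1 : #|g v :&: U|%:R <= #|U|%:R :> R by rewrite ler_nat subset_leq_card// finset.subsetIr.
apply: le_trans (ler_wpM2r (ltW l0) h1) _.
have h2 := ler_wpM2l (ler0n R #|U|) (deg_ge Hc v lam8); lra.
Qed.

(* Applied to a cell where a sparse closed set S is most populated, with x.2 the
   part of S that is visible from it, hence at most K times larger. *)
Definition heavy eta (x : cells * {set V}) : bool :=
  let t := #|x.2 :&: block cell x.1| in
  [&& x.2 \subset cell_ball cell kappa x.1, (8 * c <= t)%N, (#|x.2| <= K * t)%N & t%:R < eta * lam].

Local Notation A := ((8 * K%:R) ^+ 2 * expR 4 : R).

(** With [z = t / lam], the first two factors count the sets [x.2] and the last one bounds their
    probability. The condition [2 * K <= c] gives [K <= c - K] and [c <= 2 * (c - K)], so that all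
    constants fit into [A ^+ (c - K)]. *)
Lemma heavy_term (z : R) t : 0 < z <= 1 -> (2 * K <= c)%N ->
  z ^- (K * t) * expR (4 * K%:R * t%:R) * (8 * K%:R * z) ^+ (c * t) <=
  ((A * z) ^+ (c - K)) ^+ t.
Proof.
move=> /andP[z0 z1] Kc; rewrite !exprM expRM_natr -exprVn -!exprMn.
have K1 : 1 <= K%:R :> R by rewrite ler1n expn_gt0; clear; lia.
rewrite lerXn2r ?nnegrE//.
- by rewrite !mulr_ge0 ?invr_ge0 ?exprn_ge0 ?expR_ge0 ?mulr_ge0// ltW.
- by rewrite exprn_ge0// !mulr_ge0 ?expR_ge0 ?exprn_ge0 ?mulr_ge0// ltW.
have -> : z ^- K * expR (4 * K%:R) * (8 * K%:R * z) ^+ c =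
    expR 4 ^+ K * (8 * K%:R) ^+ c * z ^+ (c - K).
  have -> : (8 * K%:R * z) ^+ c = (8 * K%:R) ^+ c * (z ^+ (c - K) * z ^+ K).
    by rewrite exprMn -exprD subnK//; move: Kc; clear; lia.
  rewrite [4 * _]mulrC expRM_natl; field.
  by rewrite expf_neq0// gt_eqF.
rewrite [leRHS]exprMn ler_pM2r ?exprn_gt0// [leRHS]exprMn [leRHS]mulrC.
rewrite ler_pM ?exprn_ge0 ?expR_ge0 ?mulr_ge0//.
  rewrite ler_weXn2l//; first by apply: le_trans (expR_ge1Dx _); lra.
  by move: Kc; clear; lia.
rewrite -exprM ler_weXn2l//; first by lra.
by move: Kc; clear; lia.
Qed.

Lemma heavy_pr_le eta : 0 < eta <= 1 -> (2 * K <= c)%N ->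
  graph_pr R c g [pred s | [exists x : cells * {set V},
     heavy eta x && picks_in (x.2 :&: block cell x.1)%SET x.2 s]] <=
  #|{: cells}|%:R * \sum_(t < #|V|.+1 | (8 * c <= t)%N && (t%:R < eta * lam))
     ((A * (t%:R / lam)) ^+ (c - K)) ^+ t.
Proof.
move=> /andP[eta0 eta1] Kc.
have l0 : 0 < lam by exact: lt_le_trans lam8.
apply: le_trans (@graph_pr_union R V c g _ (heavy eta) _ (fun x => picks_in (x.2 :&: block cell x.1)%SET x.2) _) _.
  by move=> s _ /existsP[x /andP[hx px]]; exists x.
rewrite big_mkcond/= -(pair_bigA _ (fun q U => if heavy eta (q, U) then
  graph_pr R c g (picks_in (U :&: block cell q)%SET U) else 0))/=.
rewrite mulr_natl -sumr_const; apply: ler_sum => q _.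
rewrite -big_mkcond/=.
rewrite (partition_big (fun U : {set V} => inord #|U :&: block cell q| : 'I_(#|V|.+1))
   (fun t : 'I_(#|V|.+1) => (8 * c <= t)%N && (t%:R < eta * lam)))/=; last first.
  move=> U /and4P[_ h1 _ h2]; rewrite inordK ?h1//.
  by rewrite ltnS max_card.
apply: ler_sum => t /andP[ct teta].
case: (posnP t) => [t0|t0].
  have c0 : c = 0%N by move: ct; rewrite t0; clear; lia.
  by move: Kc; rewrite c0 leqn0 muln_eq0/= expn_eq0; clear; lia.
have z01 : 0 < t%:R / lam <= 1.
  rewrite divr_gt0 ?ltr0n//= ler_pdivrMr// mul1r.
  apply: (le_trans (ltW teta)); rewrite -[leRHS]mul1r ler_pM2r//.
have z0 : 0 < t%:R / lam by case/andP: z01.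
apply: le_trans (heavy_term t z01 Kc).
apply: (@le_trans _ _ (\sum_(U in [set U : {set V} | U \subset cell_ball cell kappa q & (#|U| <= K * t)%N]%SET)
    (8 * K%:R * (t%:R / lam)) ^+ (c * t))); last first.
  rewrite sumr_const -[leLHS]mulr_natl ler_wpM2r ?exprn_ge0 ?mulr_ge0 ?invr_ge0 ?(ltW l0)//.
  (* The free parameter of the count is taken to be [t / lam]; its product with the size of the ball
     is then at most [4 * K * t]. *)
  apply: (le_trans (card_small_subsets _ _ z01)).
  rewrite ler_pM2l ?invr_gt0 ?exprn_gt0// ler_expR.
  apply: le_trans (ler_wpM2l (ltW z0) (card_ball Hc kappa q)) _.
  rewrite le_eqVlt; apply/orP; left; apply/eqP; field.
  by rewrite gt_eqF.
rewrite big_mkcond [leRHS]big_mkcond/=; apply: ler_sum => U _.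
have r0 : 0 <= (8 * K%:R * (t%:R / lam)) ^+ (c * t).
  by rewrite exprn_ge0// !mulr_ge0 ?invr_ge0 ?(ltW l0).
case: ifP => [/andP[/and4P[/= h1 h2 h3 h4] /eqP h5]|_]; last by case: ifP.
have Ut : #|U :&: block cell q| = t.
  by rewrite -h5 inordK// ltnS max_card.
rewrite finset.in_set h1 -Ut h3/=.
apply: picks_in_pr_le.
rewrite mulrA ler_pM2r ?invr_gt0// -mulrA ler_pM2l// -natrM ler_nat Ut.
by rewrite -Ut.
Qed.

Variable rho0 : nat.
Local Notation K' := ((4 * (kappa * rho0) + 1) ^ d)%N.
Local Notation u0 := (8 * c * K')%N.

(* x.2 and W are the parts of S in two consecutive balls. The exponents are those
   of the union bound: about lam^u sets x.2 of size u in each of the n / lam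
   positions, each of probability about lam^(- c |W|). *)
Definition light (x : 'I_rho0 * cells * {set V}) : bool :=
  let q := x.1.2 in
  let W := (x.2 :&: cell_ball cell (kappa * x.1.1) q)%SET in
  [&& x.2 \subset cell_ball cell (kappa * x.1.1.+1) q, (#|x.2| <= u0)%N &
    (c ^ 2 + #|x.2| <= c * #|W| + 1)%N].

(** A set of size [u] can be picked in order [lam ^+ u] ways, while its probability is at most
    [b ^+ (c ^ 2 + u - 1)] with [b] of order [1 / lam]. Thus [u] factors [b] pay for the count,
    [c ^ 2 - 1] remain, and the sum over [u <= u0] is a constant. *)
Lemma light_pr_le : (0 < c)%N -> 8 * u0%:R <= lam ->
  graph_pr R c g [pred s | [exists x, light x &&
     picks_in (x.2 :&: cell_ball cell (kappa * x.1.1) x.1.2)%SET x.2 s]] <=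
  rho0%:R * #|{: cells}|%:R *
    (\sum_(u < u0.+1) (32 * K'%:R * u0%:R) ^+ u) * (8 * u0%:R / lam) ^+ (c ^ 2 - 1).
Proof.
move=> c0 u0lam; have l0 : 0 < lam by exact: lt_le_trans lam8.
set b := 8 * u0%:R / lam.
have b01 : 0 <= b <= 1 by rewrite divr_ge0 ?(ltW l0)//= ler_pdivrMr// mul1r.
have [b0 b1] := andP b01.
apply: le_trans (@graph_pr_union R V c g _ light _ (fun x =>
  picks_in (x.2 :&: cell_ball cell (kappa * x.1.1) x.1.2)%SET x.2) _) _.
  by move=> s _ /existsP[x /andP[hx px]]; exists x.
rewrite big_mkcond/= -(pair_bigA _ (fun x U => if light (x, U) then
  graph_pr R c g (picks_in (U :&: cell_ball cell (kappa * x.1) x.2)%SET U) else 0))/=.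
have -> : rho0%:R * #|{: cells}|%:R = #|{: 'I_rho0 * cells}|%:R :> R.
  by rewrite card_prod card_ord natrM.
rewrite -mulrA [leRHS]mulr_natl -[leRHS]sumr_const [leRHS](eq_bigl xpredT)//.
apply: ler_sum => -[rho q] _ /=.
rewrite -big_mkcond/=.
rewrite (partition_big (fun U : {set V} => inord #|U| : 'I_(u0.+1)) xpredT)//=.
rewrite mulr_suml; apply: ler_sum => u _.
have E : (32 * K'%:R * u0%:R) ^+ u * b ^+ (c ^ 2 - 1) =
    (K'%:R * (4 * lam)) ^+ u * b ^+ (c ^ 2 + u - 1).
  have -> : (c ^ 2 + u - 1 = u + (c ^ 2 - 1))%N by move: c0; clear; nia.
  rewrite exprD [RHS]mulrA -exprMn; congr (_ ^+ _ * _); rewrite /b; field.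
  by rewrite gt_eqF.
rewrite E.
apply: (@le_trans _ _ (\sum_(U in [set U : {set V} | U \subset cell_ball cell (kappa * rho0) q & #|U| == u]%SET)
    b ^+ (c ^ 2 + u - 1))); last first.
  rewrite sumr_const -[leLHS]mulr_natl ler_wpM2r ?exprn_ge0//.
  apply: (@le_trans _ _ (#|cell_ball cell (kappa * rho0) q| ^ u)%N%:R).
    by rewrite ler_nat card_subsets_le.
  rewrite natrX lerXn2r ?nnegrE ?mulr_ge0 ?(ltW l0)//.
  by have := card_ball Hc (kappa * rho0) q.
rewrite big_mkcond [leRHS]big_mkcond/=; apply: ler_sum => U _.
case: ifP => [/andP[/and3P[/= h1 h2 h3] /eqP h5]|_]; last by case: ifP; rewrite ?exprn_ge0.
have Uu : #|U| = u by rewrite -h5 inordK// ltnS.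
rewrite finset.in_set Uu eqxx andbT ifT; last first.
  apply: fintype.subset_trans h1 _; apply/fintype.subsetP => v; rewrite !finset.in_set.
  move=> /forallP h; apply/forallP => k; have := h k; rewrite /torus_near.
  have : (kappa * rho.+1 <= kappa * rho0)%N by rewrite leq_mul2l ltn_ord orbT.
  clear; lia.
apply: (le_trans (@picks_in_pr_le _ _ b _)).
  by rewrite /b ler_pM2r ?invr_gt0// ler_pM2l// ler_nat.
by rewrite ler_wiXn2l//; move: h3; rewrite Uu; clear; lia.
Qed.

End SparseClosedSets.

(** By Bernoulli, [(1 + 1 / a) ^ j] exceeds [j / a]; its power [d.+1] is of order [j ^ d.+1] and
    beats the polynomial, of order [j ^ d] at [N = d.+1 * j]. The value of [j] absorbs the
    constants. *)
Lemma exp_beats_poly (a b k d : nat) : (0 < a)%N ->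
  exists N, (b * (k * N + 1) ^ d * a ^ N < a.+1 ^ N)%N.
Proof.
move=> a0; pose C := (k * d.+1 + 1)%N; pose j := (b * a ^ d.+1 * C ^ d).+1.
exists (d.+1 * j)%N.
have h1 : (a ^ j * j <= a.+1 ^ j * a)%N.
  have : forall i, (a ^ i * (a + i) <= a.+1 ^ i * a)%N.
    elim=> [|i IH]; first by rewrite !expn0 addn0.
    rewrite !expnS -mulnA; have h : (a * (a + i.+1) <= a.+1 * (a + i))%N by nia.
    apply: (@leq_trans (a.+1 * (a ^ i * (a + i)))%N); last by rewrite -mulnA leq_mul2l IH orbT.
    by rewrite mulnCA [X in (_ <= X)%N]mulnCA leq_mul2l h orbT.
  by move=> /(_ j); apply: leq_trans; rewrite leq_mul2l leq_addl orbT.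
have h2 : (a ^ (d.+1 * j) * j ^ d.+1 <= a.+1 ^ (d.+1 * j) * a ^ d.+1)%N.
  by rewrite ![(d.+1 * j)%N]mulnC !expnM -!expnMn leq_exp2r.
have h3 : ((k * (d.+1 * j) + 1) ^ d <= (C * j) ^ d)%N.
  have h : (k * (d.+1 * j) + 1 <= C * j)%N by rewrite /C mulnDl mul1n mulnA leq_add2l.
  by case: (posnP d) => [->|d0]; rewrite ?expn0 ?leq_exp2r.
rewrite -(ltn_pmul2r (_ : 0 < a ^ d.+1)%N) ?expn_gt0 ?a0//.
apply: leq_trans h2; rewrite mulnAC [X in (_ < X)%N]mulnC ltn_pmul2r ?expn_gt0 ?a0//.
apply: (@leq_ltn_trans (b * (C * j) ^ d * a ^ d.+1)%N); first by rewrite leq_mul// leq_mul.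
rewrite expnMn mulnAC mulnA [X in (_ < X)%N]expnS ltn_pmul2r ?expn_gt0//.
Qed.

(* A bounded number of points per cell gives polynomial growth, so one of the
   first rho0 balls grows by a factor of at most 1 + 1 / (5 c). *)
Lemma slow_growth (c d kappa : nat) : (0 < c)%N -> exists rho0, forall f : nat -> nat,
  (0 < f 0)%N -> (forall rho, (f rho <= (4 * (kappa * rho) + 1) ^ d * (8 * c))%N) ->
  exists rho : 'I_rho0, (5 * c * f rho.+1 <= (5 * c).+1 * f rho)%N.
Proof.
move=> c0; have c5 : (0 < 5 * c)%N by lia.
have [N hN] := exp_beats_poly (8 * c) (4 * kappa) d c5.
exists N => f f0 fle.
have [//|/existsPn none] :=
  boolP [exists rho : 'I_N, (5 * c * f rho.+1 <= (5 * c).+1 * f rho)%N].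
  by move=> /existsP.
(* Otherwise [f] would gain more than a factor [1 + 1 / (5 c)] at each of the [N] steps, against its
   polynomial bound at [N]. *)
have : forall i, (i <= N)%N -> ((5 * c).+1 ^ i <= (5 * c) ^ i * f i)%N.
  elim=> [|i IH] iN; first by rewrite !expn0 mul1n.
  have := none (Ordinal iN); rewrite -ltnNge /= => h.
  rewrite !expnS; apply: (@leq_trans ((5 * c).+1 * ((5 * c) ^ i * f i))%N).
    by rewrite leq_mul2l IH ?orbT// ltnW.
  by rewrite mulnCA -mulnA [X in (_ <= X)%N]mulnCA leq_mul2l ltnW ?orbT.
move=> /(_ N (leqnn N)) h; have := leq_trans hN h; rewrite mulnC ltn_mul2l.
by move=> /andP[_]; rewrite ltnNge [(8 * c * _)%N]mulnC -[(4 * kappa * N)%N]mulnA fle.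
Qed.

(** * Every sparse closed set yields a heavy or a light configuration *)

Section SparseDichotomy.
Variables (R : realType) (d m kappa c : nat) (V : finType) (lam eta : R).
Variables (g : V -> {set V}) (cell : V -> {ffun 'I_d -> 'I_m}).
Hypothesis Hc : cellular kappa lam g cell.
Hypothesis cdeg : forall v, (c <= #|g v|)%N.
Variable rho0 : nat.
Hypothesis c3 : (3 <= c)%N.
Hypothesis growth : forall f : nat -> nat,
  (0 < f 0)%N -> (forall rho, (f rho <= (4 * (kappa * rho) + 1) ^ d * (8 * c))%N) ->
  exists rho : 'I_rho0, (5 * c * f rho.+1 <= (5 * c).+1 * f rho)%N.
Local Notation cells := {ffun 'I_d -> 'I_m}.
Implicit Types (p q : cells) (S W U : {set V}) (s : {ffun V -> {set V}}).

Lemma cell_ball_mono rho1 rho2 q : (rho1 <= rho2)%N ->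
  cell_ball cell rho1 q \subset cell_ball cell rho2 q.
Proof.
move=> le12; apply/fintype.subsetP => v; rewrite !finset.in_set.
move=> /forallP h; apply/forallP => k; have := h k; rewrite /torus_near.
by move: le12; clear; lia.
Qed.

Lemma block_cell_ball rho q : block cell q \subset cell_ball cell rho q.
Proof.
by apply/fintype.subsetP => v; rewrite !finset.in_set => /eqP ->; exact: cell_near_refl.
Qed.

(** For [w < 5 * c] integrality turns the growth bound into [u <= w], and [w >= c.+1] gives
    [(c - 1) * w + 1 >= c ^ 2]. Equality at [u = w = c.+1] is the case of an isolated clique. For
    larger [w] there is ample room. *)
Lemma growth_exponent u w : (c.+1 <= u)%N -> (5 * c * u <= (5 * c).+1 * w)%N ->
  (c ^ 2 + u <= c * w + 1)%N.
Proof.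
move: c3; clear; move=> c3 cu uw; case: (ltnP w (5 * c)) => w5.
  have : (u <= w)%N by nia.
  nia.
nia.
Qed.

Lemma sparse_closed_picks s S :
  (forall v, s v \in choices c (g v)) -> fingraph.closed (selected s) (mem S) ->
  S != finset.set0 -> (forall q, #|S :&: block cell q|%:R < eta * lam) ->
  [exists x : cells * {set V},
     heavy kappa c lam cell eta x && picks_in (x.2 :&: block cell x.1)%SET x.2 s] ||
  [exists x : 'I_rho0 * cells * {set V}, light kappa c cell x &&
     picks_in (x.2 :&: cell_ball cell (kappa * x.1.1) x.1.2)%SET x.2 s].
Proof.
move=> adm cS S0 sparse.
(* Choices of points of [S] stay in [S] by closedness and travel at most [kappa] cells. *)
have picks rho q v : v \in S -> v \in cell_ball cell rho q ->
    s v \subset S :&: cell_ball cell (rho + kappa) q.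
  move=> vS vb; apply/fintype.subsetP => u uv; rewrite finset.in_setI; apply/andP; split.
    by have := cS v u; rewrite /selected uv => /(_ isT) <-.
  have : u \in g v by have := adm v; rewrite finset.in_set => /andP[/fintype.subsetP/(_ u uv)].
  move=> /(nbr_near Hc) vu; rewrite finset.in_set; apply: cell_near_trans vu.
  by move: vb; rewrite finset.in_set.
have [/existsP[q1 hq1]|/existsPn small] := boolP [exists q, (8 * c <= #|S :&: block cell q|)%N].
  apply/orP; left.
  (* In a fullest cell [q], the at most [K] cells visible from it hold no more points of [S] each,
     whence [#|U| <= K * t]. *)
  have [q _ qmax] := @arg_maxnP _ q1 xpredT (fun q => #|S :&: block cell q|) isT.
  pose U := (S :&: cell_ball cell kappa q)%SET.
  have UE : (U :&: block cell q = S :&: block cell q)%SET.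
    by rewrite -finset.setIA (finset.setIidPr (block_cell_ball _ _)).
  apply/existsP; exists (q, U); rewrite /heavy /picks_in /= UE sparse andbT.
  rewrite finset.subsetIr (leq_trans hq1 (qmax q1 isT))/=; apply/andP; split.
    apply: (card_ball_fibers (rho := kappa) (q := q) (cell := cell)); first exact: finset.subsetIr.
    move=> q'; apply: leq_trans (qmax q' isT); rewrite subset_leq_card// finset.setSI//.
    exact: finset.subsetIl.
  apply/forall_inP => v; rewrite finset.in_setI => /andP[vS vq].
  by apply: (picks 0%N q v vS); have := fintype.subsetP (block_cell_ball 0 q) _ vq.
apply/orP; right.
have [v0 v0S] := set0Pn _ S0; pose q := cell v0.
pose f rho := #|S :&: cell_ball cell (kappa * rho) q|.
have v0b rho : v0 \in cell_ball cell rho q by rewrite finset.in_set cell_near_refl.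
have f0 : (0 < f 0)%N by apply/card_gt0P; exists v0; rewrite finset.in_setI v0S v0b.
have fle rho : (f rho <= (4 * (kappa * rho) + 1) ^ d * (8 * c))%N.
  apply: (card_ball_fibers (q := q) (cell := cell)); first exact: finset.subsetIr.
  move=> q'; have := small q'; rewrite -ltnNge => /ltnW; apply: leq_trans.
  by rewrite subset_leq_card// finset.setSI// finset.subsetIl.
have [rho hrho] := growth f0 fle.
pose U := (S :&: cell_ball cell (kappa * rho.+1) q)%SET.
have UE : (U :&: cell_ball cell (kappa * rho) q = S :&: cell_ball cell (kappa * rho) q)%SET.
  by rewrite -finset.setIA (finset.setIidPr (cell_ball_mono _ _))// leq_mul2l leqnSn orbT.
have pU v : v \in (S :&: cell_ball cell (kappa * rho) q)%SET -> s v \subset U.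
  by rewrite finset.in_setI => /andP[vS vb]; rewrite /U mulnSr; exact: picks.
apply/existsP; exists (rho, q, U); rewrite /light /picks_in /= UE.
apply/andP; split; last by apply/forall_inP.
rewrite finset.subsetIr /=; apply/andP; split.
  apply: leq_trans (fle rho.+1) _; rewrite mulnC leq_mul//.
  have h : (4 * (kappa * rho.+1) + 1 <= 4 * (kappa * rho0) + 1)%N.
    by rewrite leq_add2r !leq_mul2l ltn_ord !orbT.
  by case: (posnP d) => [->|d0]; rewrite ?expn0 ?leq_exp2r.
(* The larger ball contains [v0] and its [c] choices, hence at least [c.+1] points of [S]. *)
apply: growth_exponent hrho.
have v0W : v0 \in (S :&: cell_ball cell (kappa * rho) q)%SET by rewrite finset.in_setI v0S v0b.
have sv0 := adm v0; rewrite finset.in_set (minn_idPl (cdeg v0)) in sv0.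
have [/fintype.subsetP sg /eqP <-] := andP sv0.
have v0s : v0 \notin s v0 by apply/negP => /sg; rewrite (negPf (nbr_irrefl Hc v0)).
rewrite -[X in (X <= _)%N]add1n -[1%N](_ : (v0 \notin s v0) = 1%N :> nat); last by rewrite v0s.
rewrite -cardsU1 subset_leq_card// finset.subUset (pU _ v0W) andbT finset.sub1set.
by rewrite finset.in_setI v0S v0b.
Qed.

End SparseDichotomy.

Lemma graph_pr_or (R : realType) (V : finType) c (g : V -> {set V})
    (P Q1 Q2 : pred {ffun V -> {set V}}) :
  (forall s : {ffun V -> {set V}}, (forall v, s v \in choices c (g v)) -> P s -> Q1 s || Q2 s) ->
  graph_pr R c g P <= graph_pr R c g Q1 + graph_pr R c g Q2.
Proof.
move=> PQ; apply: le_trans (@graph_pr_union R V c g _ xpredT P (fun b => if b then Q1 else Q2) _) _.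
  by move=> s sv Ps; case/orP: (PQ s sv Ps) => h; [exists true|exists false].
by rewrite big_bool.
Qed.

(** * Connection above the threshold *)

Section ConnectedRegime.
Variable R : realType.

(** Two ranges of [t]. If [t ^ 2 <= lam], then [w ^+ 2 <= A ^+ 2 / lam], and the exponent
    [(c - K) * t >= 4 * c ^ 2] cancels [n ^+ 2] against [lam ^+ (2 * c ^ 2)]. Otherwise
    [w <= expR (-1)] gives [expR (- t)], while [n ^+ 2] is at most the power [4 * c ^ 2] of [t]. *)
Lemma heavy_term_small (A eta lam tau n eps x2 : R) (K c t : nat) :
  0 < A -> A * eta = expR (-1) -> 0 < lam -> x2 ^+ 2 <= lam -> 0 <= x2 ->
  0 <= n -> n <= tau * lam ^+ (c ^ 2) -> 0 <= tau <= 1 -> tau * (2 * A ^+ (4 * c ^ 2)) <= eps ->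
  (forall x : R, x2 <= x -> x ^+ (4 * c ^ 2) * expR (- x) <= eps / 2) ->
  (2 * K <= c)%N -> (0 < c)%N -> (8 * c <= t)%N -> t%:R < eta * lam ->
  2 * n ^+ 2 * ((A * (t%:R / lam)) ^+ (c - K)) ^+ t <= eps.
Proof.
move=> A0 Aeta l0 x2lam x20 n0 nlam /andP[tau0 tau1] tauA hx2 Kc c0 ct teta.
set w := A * (t%:R / lam).
have w0 : 0 <= w by rewrite mulr_ge0 ?divr_ge0// ltW.
have we : w <= expR (-1).
  rewrite /w mulrA ler_pdivrMr// -Aeta -mulrA ler_pM2l//; exact: ltW.
have w1 : w <= 1 by apply: le_trans we _; rewrite expR_le1; lra.
have tauL : tau * lam ^+ (c ^ 2) <= lam ^+ (c ^ 2) by rewrite ler_piMl// exprn_ge0// ltW.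
rewrite -exprM -mulrA; have [tl|lt] := leP (t%:R ^+ 2) lam.
  have wt : w ^+ ((c - K) * t) <= A ^+ (4 * c ^ 2) / lam ^+ (2 * c ^ 2).
    apply: (@le_trans _ _ (w ^+ (4 * c ^ 2))).
      by rewrite ler_wiXn2l//; move: Kc ct; clear; nia.
    rewrite (_ : 4 * c ^ 2 = 2 * (2 * c ^ 2))%N; last by clear; lia.
    rewrite (exprM w 2) (exprM A 2) -expr_div_n lerXn2r ?nnegrE ?divr_ge0 ?exprn_ge0 ?(ltW A0) ?(ltW l0)//.
    rewrite exprMn expr_div_n ler_pM2l ?exprn_gt0// ler_pdivrMr ?exprn_gt0//.
    by rewrite [lam ^+ 2]expr2 mulKf// gt_eqF.
  apply: (@le_trans _ _ (2 * ((tau * lam ^+ (c ^ 2)) ^+ 2 * (A ^+ (4 * c ^ 2) / lam ^+ (2 * c ^ 2))))).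
    rewrite ler_pM2l// ler_pM ?exprn_ge0// lerXn2r ?nnegrE//.
    by rewrite mulr_ge0 ?exprn_ge0// ltW.
  have -> : (tau * lam ^+ (c ^ 2)) ^+ 2 * (A ^+ (4 * c ^ 2) / lam ^+ (2 * c ^ 2)) =
      tau ^+ 2 * A ^+ (4 * c ^ 2).
    rewrite exprMn -exprM [(2 * c ^ 2)%N]mulnC; field.
    by rewrite expf_neq0// gt_eqF.
  have Ak : 0 <= A ^+ (4 * c ^ 2) by rewrite exprn_ge0 ?ltW.
  have : tau ^+ 2 * A ^+ (4 * c ^ 2) <= tau * A ^+ (4 * c ^ 2).
    by rewrite ler_wpM2r// expr2 ler_piMl.
  lra.
have tx : x2 <= t%:R.
  by rewrite -(ler_pXn2r (_ : 0 < 2)%N) ?nnegrE// (le_trans x2lam)// ltW.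
have wt : w ^+ ((c - K) * t) <= expR (- t%:R).
  apply: (@le_trans _ _ (w ^+ t)).
    by rewrite ler_wiXn2l// leq_pmull//; move: Kc c0; clear; lia.
  by rewrite -mulrN1 expRM_natl lerXn2r ?nnegrE ?expR_ge0.
have nt : n ^+ 2 <= t%:R ^+ (4 * c ^ 2).
  apply: (@le_trans _ _ ((lam ^+ (c ^ 2)) ^+ 2)).
    by rewrite lerXn2r ?nnegrE ?exprn_ge0 ?(ltW l0)//; apply: le_trans tauL.
  rewrite (_ : 4 * c ^ 2 = 2 * (c ^ 2 * 2))%N; last by clear; lia.
  by rewrite -exprM [leRHS]exprM lerXn2r ?nnegrE ?exprn_ge0 ?(ltW l0) ?(ltW lt).
have := hx2 _ tx.
have := ler_pM (exprn_ge0 2 n0) (exprn_ge0 _ w0) nt wt.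
lra.
Qed.

(** There are at most [4 * n / lam] cells, and this extra factor [1 / lam] raises the exponent from
    [k] to [k.+1], which is [c ^ 2] in the application. *)
Lemma light_term_small (M lam n tau C S u eps : R) (k : nat) : 0 < lam ->
  M * lam <= 4 * n -> n <= tau * lam ^+ k.+1 -> 0 <= C -> 0 <= S -> 0 <= u ->
  tau * (4 * (C * S * u ^+ k)) <= eps ->
  C * M * S * (u / lam) ^+ k <= eps.
Proof.
move=> l0 Mn nlam C0 S0 u0 tauC.
have -> : C * M * S * (u / lam) ^+ k = C * S * u ^+ k * (M * lam) / lam ^+ k.+1.
  rewrite expr_div_n exprS; field.
  by rewrite expf_neq0 gt_eqF.
rewrite ler_pdivrMr ?exprn_gt0//.
have c0 : 0 <= C * S * u ^+ k by rewrite !mulr_ge0// exprn_ge0.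
have h1 := ler_wpM2l c0 Mn.
have h2 := ler_wpM2l c0 nlam.
have h3 : tau * (4 * (C * S * u ^+ k)) * lam ^+ k.+1 <= eps * lam ^+ k.+1.
  by rewrite ler_wpM2r// exprn_ge0// ltW.
lra.
Qed.

Variables (d kappa : nat).
Local Notation K := ((4 * kappa + 1) ^ d)%N.

(** The bound [c0] depends only on [d] and [kappa], so that it can be fixed before [delta] tends to
    0. *)
Lemma cellular_connected : exists c0 : nat, forall c, (c0 <= c)%N ->
  forall eps : R, 0 < eps -> exists lam0 tau : R, 0 < tau /\
  forall (m : nat) (V : finType) (lam : R) (g : V -> {set V}) (cell : V -> {ffun 'I_d -> 'I_m}),
  cellular kappa lam g cell -> lam0 <= lam -> #|V|%:R <= tau * lam ^+ (c ^ 2) ->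
  graph_pr R c g [pred s | ~~ connectedb s] <= eps.
Proof.
have K1 : 1 <= K%:R :> R by rewrite ler1n expn_gt0; clear; lia.
pose A : R := (8 * K%:R) ^+ 2 * expR 4.
have A64 : 64 <= A.
  rewrite /A -[leLHS]mulr1 ler_pM//; last by rewrite -expR0 ler_expR.
  by rewrite expr2; have := mulr_ege1 K1 K1; lra.
have A0 : 0 < A by lra.
(* With this density the base [A * (t / lam)] of the heavy terms stays below [expR (-1)]. *)
pose eta : R := expR (-1) / A.
have eta0 : 0 < eta by rewrite divr_gt0 ?expR_gt0.
have Aeta : A * eta = expR (-1) by rewrite /eta mulrC divfK ?gt_eqF.
have eta8 : eta < 8^-1.
  rewrite /eta ltr_pdivrMr//; apply: (@le_lt_trans _ _ 1); first by rewrite expR_le1; lra.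
  by lra.
have AE : (8 * K%:R) ^+ 2 * expR 4 = A by [].
clearbody A eta.
(* The summands serve [growth_exponent], [heavy_term] and [mixing_pr] respectively. *)
exists (3 + 2 * K + (Num.truncn (288 * K%:R / eta)).+1)%N => c c_ge.
have c3 : (3 <= c)%N by move: c_ge; clear; lia.
have cK : (2 * K <= c)%N by move: c_ge; clear; lia.
have ceta : 288 * K%:R <= c%:R * eta.
  rewrite -ler_pdivrMr//; apply: ltW; apply: lt_le_trans (truncnS_gt _) _.
  by rewrite ler_nat (leq_trans _ c_ge)// leq_addl.
clear c_ge; have c0 : (0 < c)%N by move: c3; clear; lia.
move=> eps eps0.
have [rho0 growth] := slow_growth d kappa c0.
pose u0 := (8 * c * (4 * (kappa * rho0) + 1) ^ d)%N.
pose Su : R := \sum_(u < u0.+1) (32 * ((4 * (kappa * rho0) + 1) ^ d)%:R * u0%:R) ^+ u.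
have Su0 : 0 <= Su by apply: sumr_ge0 => u _; rewrite exprn_ge0.
pose k := (c ^ 2).-1; have kE : (c ^ 2 = k.+1)%N by rewrite /k prednK// expn_gt0 c0.
have eps3 : 0 < eps / 3 by rewrite divr_gt0.
have [x1 [x10 hx1]] := exprMexpRN_small (2 * c ^ 2) eps3.
have eps6 : 0 < eps / 3 / 2 by rewrite divr_gt0.
have [x2 [x20 hx2]] := exprMexpRN_small (4 * c ^ 2) eps6.
pose C1 : R := 4 * (rho0%:R * Su * (8 * u0%:R) ^+ k); pose C2 : R := 2 * A ^+ (4 * c ^ 2).
have C10 : 0 <= C1 by rewrite !mulr_ge0// exprn_ge0// mulr_ge0.
have C20 : 0 <= C2 by rewrite !mulr_ge0// exprn_ge0// ltW.
have D0 : 0 < eps / 3 + C1 + C2 by lra.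
(* This ratio makes [tau <= 1], [tau * C1 <= eps / 3] and [tau * C2 <= eps / 3] hold together. *)
pose tau := (eps / 3) / (eps / 3 + C1 + C2).
have tau0 : 0 < tau by rewrite divr_gt0.
have tauE : tau * (eps / 3 + C1 + C2) = eps / 3 by rewrite /tau divfK// gt_eqF.
have tau1 : tau <= 1 by rewrite /tau ler_pdivrMr//; lra.
have tC1 : tau * C1 <= eps / 3 by rewrite -tauE ler_pM2l//; lra.
have tC2 : tau * C2 <= eps / 3 by rewrite -tauE ler_pM2l//; lra.
clearbody tau.
exists (8 + 8 * c%:R + x1 + x2 ^+ 2 + 8 * u0%:R), tau; split=> // m V lam g cell Hc hlam nlam.
have x22 : 0 <= x2 ^+ 2 by rewrite exprn_ge0// ltW.
have [cc uu] : 0 <= c%:R :> R /\ 0 <= u0%:R :> R by [].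
have lam8 : 8 <= lam by clear - hlam x22 cc uu x10; lra.
have lamc : c%:R <= lam / 8 by clear - hlam x22 cc uu x10; lra.
have lamx1 : x1 <= lam by clear - hlam x22 cc uu x10; lra.
have lamx2 : x2 ^+ 2 <= lam by clear - hlam x22 cc uu x10; lra.
have lamu : 8 * u0%:R <= lam by clear - hlam x22 cc uu x10; lra.
have l0 : 0 < lam by clear -lam8; lra.
have cdeg v : (c <= #|g v|)%N by rewrite -(ler_nat R) (le_trans lamc)// (deg_ge Hc).
have Mlam := cells_le Hc; set M : R := #|_|%:R in Mlam.
set n : R := #|V|%:R in Mlam nlam.
have [M0 n0] : 0 <= M /\ 0 <= n by [].
have Mn : M <= n.
  rewrite -(ler_pM2r l0); apply: (le_trans Mlam); rewrite mulrC ler_wpM2l//.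
  by clear -lam8; lra.
have tauL : tau * lam ^+ (c ^ 2) <= lam ^+ (c ^ 2) by rewrite ler_piMl// exprn_ge0// ltW.
have etaT : 0 < eta <= 1 by rewrite eta0; clear -eta8; lra.
have mix := mixing_pr Hc lam8 cdeg eta0 ceta.
have hvy := heavy_pr_le Hc lam8 cdeg etaT cK.
rewrite AE in hvy; have lgt := @light_pr_le R d m kappa c V lam g cell Hc lam8 cdeg rho0 c0 lamu.
set P1 := [pred s | _] in mix; set P2 := [pred s | _] in hvy; set P3 := [pred s | _] in lgt.
(* A disconnected outcome splits a clique, or contains a heavy configuration, or a light one; each
   event receives [eps / 3]. *)
apply: (le_trans (@graph_pr_or R V c g _ P1 [pred s | P2 s || P3 s] _)).
  move=> s adm /= ncon; case: (boolP [exists x, unmixed lam eta cell x && split_by cell s x]) => //= nP1.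
  have nsplit x : unmixed lam eta cell x -> ~~ split_by cell s x.
    by move=> ux; apply: contra nP1 => sx; apply/existsP; exists x; rewrite ux.
  have [S [cS S0 sparse]] := disconnected_sparse Hc lam8 eta8 nsplit ncon.
  exact: (sparse_closed_picks Hc cdeg c3 growth adm cS S0 sparse).
have : graph_pr R c g [pred s | P2 s || P3 s] <= graph_pr R c g P2 + graph_pr R c g P3.
  exact: graph_pr_or.
have b1 : graph_pr R c g P1 <= eps / 3.
  apply: (le_trans mix); apply: le_trans (hx1 _ lamx1); rewrite ler_pM2r ?expR_gt0//.
  rewrite mulnC exprM lerXn2r ?nnegrE ?exprn_ge0 ?(ltW l0)//.
  by apply: (le_trans Mn); apply: le_trans tauL.
have b3 : graph_pr R c g P3 <= eps / 3.
  apply: (le_trans lgt); rewrite kE subn1 /=.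
  apply: (@light_term_small M lam n tau rho0%:R Su (8 * u0%:R) (eps / 3) k) => //.
  by rewrite -kE.
have b2 : graph_pr R c g P2 <= eps / 3.
  apply: (le_trans hvy).
  (* The share [eps / 3] is divided evenly among the values of [t]; the factor
     [n * (n + 1) <= 2 * n ^+ 2] explains the form of [heavy_term_small]. *)
  have term (t : 'I_(#|V|.+1)) : (8 * c <= t)%N && (t%:R < eta * lam) ->
      n * ((A * (t%:R / lam)) ^+ (c - K)) ^+ t <= eps / 3 / (#|V|.+1)%:R.
    move=> /andP[ct teta]; rewrite ler_pdivlMr ?ltr0n//.
    have tau01 : 0 <= tau <= 1 by rewrite tau1 ltW.
    have := heavy_term_small A0 Aeta l0 lamx2 (ltW x20) n0 nlam tau01 tC2 hx2 cK c0 ct teta.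
    apply: le_trans; rewrite mulrAC ler_wpM2r//.
      by rewrite !exprn_ge0// mulr_ge0 ?(ltW A0)// divr_ge0 ?(ltW l0).
    rewrite -natr1 -/n mulrDr mulr1 expr2.
    have : n <= n * n by rewrite /n -natrM ler_nat; case: (#|V|) => // j; rewrite leq_pmulr.
    clear; lra.
  have h : 0 <= \sum_(t < #|V|.+1 | (8 * c <= t)%N && (t%:R < eta * lam))
      ((A * (t%:R / lam)) ^+ (c - K)) ^+ t.
    by apply: sumr_ge0 => t _; rewrite !exprn_ge0// mulr_ge0 ?(ltW A0)// divr_ge0 ?(ltW l0).
  apply: (le_trans (ler_wpM2r h Mn)); rewrite mulr_sumr.
  apply: (le_trans (ler_sum _ term)).
  apply: (@le_trans _ _ (\sum_(t < #|V|.+1) eps / 3 / (#|V|.+1)%:R)).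
    rewrite [leLHS]big_mkcond; apply: ler_sum => t _; case: ifP => // _.
    by rewrite divr_ge0// ltW.
  by rewrite sumr_const card_ord -[leLHS]mulr_natr divfK// pnatr_eq0.
move=> h; clear - b1 b2 b3 h; lra.
Qed.

End ConnectedRegime.

Local Open Scope classical_set_scope.

(** * Conditioning on the points *)

Section FinitePartition.
Context (dp : measure_display) (T : measurableType dp) (R : realType).
Variable P : probability T R.

Lemma measurable_exists (I : finType) (F : I -> set T) :
  (forall i, measurable (F i)) -> measurable [set w | exists i, F i w].
Proof.
move=> mF; rewrite (_ : [set w | _] = \bigcup_(i in [set: I]) F i).
  by apply: fin_bigcup_measurable => //; exact: finite_finset.
by apply/seteqP; split=> [w [i Fi]|w [i _ Fi]]; exists i.
Qed.

Lemma measurable_forall (I : finType) (F : I -> set T) :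
  (forall i, measurable (F i)) -> measurable [set w | forall i, F i w].
Proof.
move=> mF; rewrite (_ : [set w | _] = \bigcap_(i in [set: I]) F i).
  by apply: fin_bigcap_measurable => //; exact: finite_finset.
by apply/seteqP; split=> w Fw i => [_|]; exact: Fw.
Qed.

Section Preimage.
Variables (I : finType) (X : T -> I).
Hypothesis mX : forall i, measurable (X @^-1` [set i]).

Lemma measurable_finpreimage (Q : pred I) : measurable [set w | Q (X w)].
Proof.
rewrite (_ : [set w | _] = [set w | exists i : {i : I | Q i}, X w = val i]).
  by apply: measurable_exists => i; exact: mX.
apply/seteqP; split=> [w /= Qw|w [[i /= Qi] /= ->]//].
by exists (exist _ (X w) Qw).
Qed.

Lemma probability_finpreimage (Q : pred I) :
  P [set w | Q (X w)] = (\sum_(i | Q i) P (X @^-1` [set i]))%E.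
Proof.
have seqP (s : seq I) : uniq s ->
    P [set w | X w \in s] = (\sum_(i <- s) P (X @^-1` [set i]))%E.
  elim: s => [|i s IH] /=.
    by move=> _; rewrite big_nil (_ : [set w | _] = set0) ?measure0// -subset0 => w.
  move=> /andP[nis us]; rewrite big_cons -IH// -measureU//.
  - congr (P _); apply/seteqP; split=> w /=.
      by rewrite inE => /orP[/eqP|]; [left|right].
    by rewrite inE => -[->|->]; rewrite ?eqxx ?orbT.
  - exact: (measurable_finpreimage (mem s)).
  - by rewrite -subset0 => w [/= -> ]; rewrite (negPf nis).
rewrite -big_filter -seqP ?filter_uniq ?index_enum_uniq//.
by congr (P _); apply/seteqP; split=> w /=; rewrite mem_filter mem_index_enum andbT.
Qed.

End Preimage.

Lemma probability_exists_le (I : finType) (Q : pred I) (F : I -> set T) :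
  (forall i, measurable (F i)) ->
  (P [set w | exists2 i, Q i & F i w] <= \sum_(i | Q i) P (F i))%E.
Proof.
move=> mF.
have seqP (s : seq I) : measurable [set w | exists2 i, i \in s & F i w] /\
    (P [set w | exists2 i, i \in s & F i w] <= \sum_(i <- s) P (F i))%E.
  elim: s => [|i s [mIH IH]].
    rewrite big_nil (_ : [set w | _] = set0) ?measure0//.
    by rewrite -subset0 => w [].
  rewrite (_ : [set w | _] = F i `|` [set w | exists2 i, i \in s & F i w]).
    split; first exact: measurableU.
    by rewrite big_cons; apply: le_trans (measureU2 P (mF i) mIH) _; rewrite leeD2l.
  apply/seteqP; split=> [w [j]|w [Fi|[j js Fj]]].
  - by rewrite inE => /orP[/eqP ->|js Fj]; [left|right; exists j].
  - by exists i; rewrite ?inE ?eqxx.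
  - by exists j; rewrite ?inE ?js ?orbT.
rewrite -big_filter; apply: le_trans (seqP _).2; rewrite le_eqVlt; apply/orP; left; apply/eqP.
congr (P _); apply/seteqP; split=> w [i Qi Fi]; exists i => //; move: Qi.
  by rewrite mem_filter mem_index_enum andbT.
by rewrite mem_filter => /andP[].
Qed.

End FinitePartition.

Section Disintegration.
Variables (R : realType) (d n : nat) (r : R) (c : nat).
Implicit Types (x : n.-tuple (d.-tuple R)).

(** The law of the choices depends on the points only through this finite-valued map, which reduces
    conditioning to finite sums. *)
Definition nbr_map x : {ffun 'I_n -> {set 'I_n}} := [ffun i => rgg_nbrs r x i].

Lemma measurable_coord (i : 'I_n) (k : 'I_d) :
  measurable_fun [set: n.-tuple (d.-tuple R)] (fun x => tnth (tnth x i) k).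
Proof. exact: (measurableT_comp (measurable_tnth k) (measurable_tnth i)). Qed.

Lemma measurable_torus_dist (i j : 'I_n) :
  measurable_fun [set: n.-tuple (d.-tuple R)] (fun x => torus_dist (tnth x i) (tnth x j)).
Proof.
rewrite /torus_dist.
have mS : measurable_fun [set: n.-tuple (d.-tuple R)] (fun x => \sum_(k < d)
    Num.min `|tnth (tnth x i) k - tnth (tnth x j) k|
      (1 - `|tnth (tnth x i) k - tnth (tnth x j) k|) ^+ 2).
  apply: measurable_sum => k; apply: measurable_realfun.measurable_funX.
  have mD : measurable_fun [set: n.-tuple (d.-tuple R)]
      (fun x => `|tnth (tnth x i) k - tnth (tnth x j) k|).
    apply: measurableT_comp => //; apply: measurable_realfun.measurable_funB; exact: measurable_coord.
  by apply: measurable_realfun.measurable_minr => //; apply: measurable_realfun.measurable_funB.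
apply: measurableT_comp mS; apply: measurable_realfun.continuous_measurable_fun; exact: sqrt_continuous.
Qed.

Lemma measurable_nbr_map h : measurable (nbr_map @^-1` [set h]).
Proof.
rewrite (_ : _ @^-1` _ = [set x | forall ij : 'I_n * 'I_n,
   rgg_adj r x ij.1 ij.2 = (ij.2 \in h ij.1)]).
  apply: measurable_forall => -[i j] /=.
  have mle : measurable [set x : n.-tuple (d.-tuple R) | torus_dist (tnth x i) (tnth x j) <= r].
    have := measurable_fun_le measurableT (measurable_torus_dist i j) (@measurable_cst _ _ _ _ setT r).
    by rewrite setTI.
  rewrite /rgg_adj; case: (i != j) => /=; case: (j \in h i).
  - exact: mle.
  - rewrite [X in measurable X](_ : _ = ~` [set x | torus_dist (tnth x i) (tnth x j) <= r]).
      exact: measurableC.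
    by apply/seteqP; split=> x /= => [->|/negP/negPf].
  - by rewrite [X in measurable X](_ : _ = set0)// -subset0.
  - by rewrite [X in measurable X](_ : _ = setT)// -subTset.
apply/seteqP; split=> x /= => [<- [i j]|hx].
  by rewrite /= ffunE finset.in_set.
by apply/ffunP => i; rewrite ffunE; apply/setP => j; rewrite finset.in_set (hx (i, j)).
Qed.

Variable G : bluetooth_graph d n r c.
Local Notation P := (bt_prob G).

Definition nbr_pr (h : {ffun 'I_n -> {set 'I_n}}) : R :=
  fine (P [set w | nbr_map (bt_points w) = h]).

Lemma measurable_points_preimage (B : set (n.-tuple (d.-tuple R))) :
  measurable B -> measurable [set w | B (bt_points (b := G) w)].
Proof.
by move=> mB; have := bt_points_measurable (b := G) measurableT mB; rewrite setTI.
Qed.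

Lemma measurable_nbr h : measurable [set w | nbr_map (bt_points (b := G) w) = h].
Proof. exact: (measurable_points_preimage (measurable_nbr_map h)). Qed.

Lemma probability_finE (A : set (bt_space G)) : measurable A -> P A = (fine (P A))%:E.
Proof.
move=> mA; rewrite fineK// fin_numE; apply/andP; split.
  by rewrite gt_eqF// (lt_le_trans _ (measure_ge0 P A)).
by rewrite lt_eqF// (le_lt_trans (probability_le1 P mA))// ltry.
Qed.

(** The integrand in the law of the choices is constant where the neighbourhoods equal [h]. *)
Lemma nbr_choices_pr h s :
  P [set w | nbr_map (bt_points w) = h /\ bt_choices w = s] =
  (nbr_pr h * \prod_i choice_pr R c (h i) (s i))%:E.
Proof.
have := bt_choices_law G s (measurable_nbr_map h).
set A := _ `&` _ => PA; rewrite (_ : [set w | _] = A)// PA.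
rewrite (@eq_integral _ _ _ _ _ (cst (\prod_i choice_pr R c (h i) (s i))%:E)).
  rewrite integral_cst; last exact: measurable_nbr.
  by rewrite mulrC EFinM /nbr_pr -probability_finE//; exact: measurable_nbr.
move=> w /set_mem /= <-; congr (_%:E); apply: eq_bigr => i _.
by rewrite ffunE.
Qed.

Lemma choices_prE (D : pred {ffun 'I_n -> {set 'I_n}}) :
  P [set w | D (bt_choices w)] = (\sum_h nbr_pr h * graph_pr R c h D)%:E.
Proof.
pose X (w : bt_space G) := (nbr_map (bt_points w), bt_choices w).
have mX hs : measurable (X @^-1` [set hs]).
  rewrite (_ : _ @^-1` _ = [set w | nbr_map (bt_points (b := G) w) = hs.1] `&`
    (bt_choices (b := G) @^-1` [set hs.2])).
    by apply: measurableI; [exact: measurable_nbr|exact: bt_choices_measurable].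
  case: hs => h s; apply/seteqP; split=> w; rewrite /X /=; first by case=> -> ->.
  by case=> -> ->.
rewrite (probability_finpreimage P mX (fun hs => D hs.2)).
rewrite (eq_bigr (fun hs : {ffun 'I_n -> {set 'I_n}} * {ffun 'I_n -> {set 'I_n}} =>
    (nbr_pr hs.1 * \prod_i choice_pr R c (hs.1 i) (hs.2 i))%:E)).
  rewrite sumEFin; congr _%:E; rewrite /graph_pr.
  under [RHS]eq_bigr do rewrite mulr_sumr.
  by rewrite pair_big.
move=> [h s] _; rewrite -nbr_choices_pr; congr (P _).
by apply/seteqP; split=> w; rewrite /X /=; [case=> -> ->|case=> -> ->].
Qed.

Lemma nbr_pr_ge0 h : 0 <= nbr_pr h.
Proof. by rewrite fine_ge0. Qed.

Lemma sum_nbr_pr (Q : pred {ffun 'I_n -> {set 'I_n}}) :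
  P [set w | Q (nbr_map (bt_points w))] = (\sum_(h | Q h) nbr_pr h)%:E.
Proof.
rewrite (@probability_finpreimage _ _ _ P _ (fun w => nbr_map (bt_points w)) measurable_nbr).
by rewrite -sumEFin; apply: eq_bigr => h _; rewrite -probability_finE//; exact: measurable_nbr.
Qed.

Lemma measurable_choices (D : pred {ffun 'I_n -> {set 'I_n}}) :
  measurable [set w | D (bt_choices (b := G) w)].
Proof. by apply: measurable_finpreimage => s; exact: bt_choices_measurable. Qed.

(** Neighbourhood systems with conditional probability above [eps] occur only outside [E]; they are
    charged in full, and all others contribute at most [eps]. *)
Lemma choices_pr_le (D : pred {ffun 'I_n -> {set 'I_n}}) (E : set (bt_space G)) (eps : R) :
  measurable E -> 0 <= eps ->
  (forall w, E w -> graph_pr R c (nbr_map (bt_points w)) D <= eps) ->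
  (P [set w | D (bt_choices w)] <= P (~` E) + eps%:E)%E.
Proof.
move=> mE eps0 hE; rewrite choices_prE.
pose bad (h : {ffun 'I_n -> {set 'I_n}}) := eps < graph_pr R c h D.
apply: (@le_trans _ _ (P [set w | bad (nbr_map (bt_points w))] + eps%:E)%E); last first.
  rewrite leeD2r// le_measure// ?inE//.
  - by apply: measurable_finpreimage => h; exact: measurable_nbr.
  - exact: measurableC.
  - by move=> w /= bw Ew; move: bw; rewrite /bad ltNge hE.
rewrite sum_nbr_pr -EFinD lee_fin (bigID bad)/=.
have sum1 : \sum_h nbr_pr h = 1.
  apply: EFin_inj; rewrite -(sum_nbr_pr xpredT) -(probability_setT P).
  by congr (P _); apply/seteqP; split.
apply: lerD.
  by apply: ler_sum => h _; rewrite ler_piMr ?nbr_pr_ge0 ?graph_pr_le1.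
apply: (@le_trans _ _ (\sum_(h | ~~ bad h) nbr_pr h * eps)).
  by apply: ler_sum => h; rewrite /bad -leNgt => hh; rewrite ler_wpM2l ?nbr_pr_ge0.
rewrite -mulr_suml ler_piMl// -sum1 [leRHS](bigID bad)/= lerDr.
by apply: sumr_ge0 => h _; exact: nbr_pr_ge0.
Qed.

End Disintegration.

(** * Occupancy of the cells *)

Section Occupancy.
Variables (R : realType) (d n : nat) (r : R) (c : nat).
Variable G : bluetooth_graph d n r c.
Local Notation P := (bt_prob G).
Local Notation pt w i := (tnth (bt_points (b := G) w) i).

Lemma uniform_prob_itvco (a b : R) : 0 <= a -> a <= b -> b <= 1 ->
  uniform_prob (@ltr01 R) `[a, b[ = (b - a)%:E.
Proof.
move=> a0 ab b1; rewrite /uniform_prob (@eq_integral _ _ _ _ _ (cst 1%E)).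
  rewrite integral_cst//= mul1e lebesgue_measure_itv/= lte_fin.
  case: ifP => [_|/negbT]; first by rewrite EFinB.
  by rewrite -leNgt => ba; rewrite (le_anti (introT andP (conj ab ba))) subrr.
move=> x; rewrite inE/= in_itv/= => /andP[ax xb]; rewrite /uniform_pdf.
by rewrite (le_trans a0 ax) (le_trans (ltW xb) b1)/= subr0 invr1.
Qed.

Lemma measurable_point (i : 'I_n) (B : set (d.-tuple R)) : measurable B ->
  measurable [set w | B (pt w i)].
Proof.
move=> mB; apply: (@measurable_points_preimage _ _ _ _ _ G (fun x => B (tnth x i))).
by have := measurable_tnth i measurableT mB; rewrite setTI.
Qed.

Definition box (A : 'I_d -> set R) : set (d.-tuple R) := [set y | forall k, A k (tnth y k)].

Lemma measurable_box (A : 'I_d -> set R) : (forall k, measurable (A k)) -> measurable (box A).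
Proof.
move=> mA; apply: measurable_forall => k.
by have := measurable_tnth k measurableT (mA k); rewrite setTI.
Qed.

Lemma box_pr (i : 'I_n) (A : 'I_d -> set R) : (forall k, measurable (A k)) ->
  P [set w | box A (pt w i)] = (\prod_(k < d) uniform_prob (@ltr01 R) (A k))%E.
Proof. exact: bt_points_uniform. Qed.

Definition occupants (C : set (d.-tuple R)) (w : bt_space G) : {set 'I_n} :=
  [set i | pt w i \in C]%SET.

(** Fixing the exact set of occupants imposes one condition on each point, to which independence
    applies. *)
Lemma occupantsE C A : [set w | occupants C w = A] =
  [set w | forall i, (if i \in A then C else ~` C) (pt w i)].
Proof.
apply/seteqP; split=> w /= => [<- i|h].
  by rewrite finset.in_set; case: ifP => /=; [move/set_mem|move/negbT/negP => h1 h2; apply: h1; exact/mem_set].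
apply/setP => i; rewrite finset.in_set; have := h i; case: (i \in A) => h1.
  exact/mem_set.
by apply/negP => /set_mem.
Qed.

Section Chernoff.
Variables (C : set (d.-tuple R)) (p : R).
Hypothesis mC : measurable C.
Hypothesis p01 : 0 <= p <= 1.
Hypothesis Cp : forall i, P [set w | C (pt w i)] = p%:E.

Lemma measurable_occupants A : measurable [set w | occupants C w = A].
Proof.
rewrite occupantsE; apply: measurable_forall => i; apply: measurable_point.
by case: ifP => // _; exact: measurableC.
Qed.

Lemma occupants_pr A :
  P [set w | occupants C w = A] = (p ^+ #|A| * (1 - p) ^+ (n - #|A|))%:E.
Proof.
rewrite occupantsE (@bt_points_independent _ _ _ _ _ G (fun i => if i \in A then C else ~` C)); last first.
  by move=> i; case: ifP => // _; exact: measurableC.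
rewrite (eq_bigr (fun i => (if i \in A then p else 1 - p)%:E)).
  rewrite prodEFin; congr _%:E; rewrite (bigID (mem A))/=; congr (_ * _).
    by rewrite -prodr_const; apply: eq_bigr => i ->.
  rewrite (_ : n - #|A| = #|~: A|)%N; last by rewrite [RHS]cardsCs card_ord finset.setCK.
  rewrite -prodr_const [RHS](eq_bigl (fun i => i \notin A)); last by move=> i; rewrite finset.in_setC.
  by apply: eq_bigr => i /negPf ->.
move=> i _; case: ifP => _; first exact: Cp.
rewrite -(_ : ~` [set w | C (pt w i)] = [set w | (~` C) (pt w i)])//.
by rewrite probability_setC ?Cp ?EFinB//; exact: measurable_point.
Qed.

(* Exponential tilting of the binomial law of the number of occupants. *)
Let tilt (z t : R) (Q : pred {set 'I_n}) : (forall A, Q A -> t <= z * #|A|%:R) ->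
  (P [set w | Q (occupants C w)] <= (expR (- t) * (p * expR z + (1 - p)) ^+ n)%:E)%E.
Proof.
move=> Qt; have [p0 p1] := andP p01.
rewrite (@probability_finpreimage _ _ _ P _ (occupants C) measurable_occupants).
rewrite (eq_bigr _ (fun A _ => occupants_pr A)) sumEFin lee_fin.
have := sum_subsets (finset.setTfor 'I_n) (p * expR z) (1 - p); rewrite cardsT card_ord => <-.
rewrite mulr_sumr big_mkcond [leRHS]big_mkcond/=; apply: ler_sum => A _.
rewrite finset.subsetT; case: ifP => [QA|_]; last first.
  by rewrite !mulr_ge0 ?exprn_ge0 ?mulr_ge0 ?expR_ge0 ?subr_ge0.
rewrite mulrA ler_wpM2r ?exprn_ge0 ?subr_ge0// exprMn mulrCA ler_peMr ?exprn_ge0//.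
by rewrite -[leLHS]expR0 -expRM_natl -expRD ler_expR [_%:R * z]mulrC addrC subr_ge0 Qt.
Qed.

Lemma chernoff_occupants :
  (P [set w | ~~ ((n%:R * p / 4 <= #|occupants C w|%:R) && (#|occupants C w|%:R <= 4 * (n%:R * p)))%R]
   <= (2 * expR (- (n%:R * p / 4)))%:E)%E.
Proof.
have [p0 p1] := andP p01; set lam := n%:R * p.
have lam0 : 0 <= lam by rewrite mulr_ge0.
pose Q1 (A : {set 'I_n}) := #|A|%:R < lam / 4; pose Q2 (A : {set 'I_n}) := 4 * lam < #|A|%:R.
have mQ (Q : pred {set 'I_n}) : measurable [set w | Q (occupants C w)].
  exact: (measurable_finpreimage (X := occupants C) measurable_occupants).
have e4 : expR 1 <= 4 :> R.
  rewrite (_ : 1 = 2^-1 + 2^-1 :> R) ?expRD; last by lra.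
  have : expR (2^-1) <= 2 :> R.
    rewrite -[leLHS]invrK -expRN invf_ple ?posrE ?expR_gt0//.
    by apply: le_trans (expR_ge1Dx _); lra.
  have := expR_ge0 (2^-1 : R); nra.
have e2 : expR (-1) <= 2^-1 :> R.
  by rewrite expRN lef_pV2 ?posrE ?expR_gt0// (le_trans _ (expR_ge1Dx 1)).
apply: (@le_trans _ _ (P [set w | Q1 (occupants C w)] + P [set w | Q2 (occupants C w)])%E).
  rewrite (_ : [set w | _] = [set w | Q1 (occupants C w)] `|` [set w | Q2 (occupants C w)]).
    by apply: measureU2; exact: mQ.
  apply/seteqP; split=> w /=; rewrite negb_and -!ltNge /Q1 /Q2.
    by move=> /orP.
  by move=> h; apply/orP.
(* Lower tail with tilt -1: the base is at most [1 - p / 2 <= expR (- (p / 2))]. Upper tail with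
   tilt 1: it is at most [1 + 3 * p <= expR (3 * p)]. The exponents become [lam / 4 - lam / 2] and
   [3 * lam - 4 * lam]. *)
rewrite mulr_natl mulr2n EFinD; apply: leeD.
  apply: le_trans (@tilt (-1) (- (lam / 4)) Q1 _) _.
    by move=> A; rewrite /Q1; lra.
  rewrite opprK lee_fin.
  apply: (@le_trans _ _ (expR (lam / 4) * expR (- (p / 2)) ^+ n)).
    rewrite ler_pM2l ?expR_gt0// lerXn2r ?nnegrE ?expR_ge0//.
      by rewrite addr_ge0 ?mulr_ge0 ?expR_ge0 ?subr_ge0.
    by apply: le_trans (expR_ge1Dx _); nra.
  by rewrite -expRM_natl -expRD ler_expR /lam; lra.
apply: le_trans (@tilt 1 (4 * lam) Q2 _) _.
  by move=> A; rewrite /Q2; lra.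
rewrite lee_fin.
apply: (@le_trans _ _ (expR (- (4 * lam)) * expR (3 * p) ^+ n)).
  rewrite ler_pM2l ?expR_gt0// lerXn2r ?nnegrE ?expR_ge0//.
    by rewrite addr_ge0 ?mulr_ge0 ?expR_ge0 ?subr_ge0.
  by apply: le_trans (expR_ge1Dx _); nra.
by rewrite -expRM_natl -expRD ler_expR; move: lam0; rewrite /lam; lra.
Qed.

End Chernoff.

Variable m : nat.
Hypothesis m0 : (0 < m)%N.
Local Notation lam := (n%:R * (m%:R ^+ d)^-1 : R).

Definition grid_itv (j : nat) : set R := `[j%:R / m%:R, j.+1%:R / m%:R[%classic.

Definition grid_cell (q : {ffun 'I_d -> 'I_m}) : set (d.-tuple R) := box (fun k => grid_itv (q k)).

(** The half-open cells do not cover the points with a coordinate equal to 1, hence the second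
    clause, which holds almost surely. *)
Definition balanced (w : bt_space G) : Prop :=
  (forall q, (lam / 4 <= #|occupants (grid_cell q) w|%:R) &&
             (#|occupants (grid_cell q) w|%:R <= 4 * lam)) /\
  (forall i, box (fun=> `[0, 1[%classic) (pt w i)).

Lemma measurable_grid_cell q : measurable (grid_cell q).
Proof. by apply: measurable_box => k; exact: measurable_itv. Qed.

Lemma grid_cell_pr q i : P [set w | grid_cell q (pt w i)] = ((m%:R ^+ d)^-1)%:E.
Proof.
have m0R : 0 < m%:R :> R by rewrite ltr0n.
rewrite box_pr; last by move=> k; exact: measurable_itv.
rewrite (eq_bigr (fun=> (m%:R^-1 : R)%:E)).
  by rewrite prodEFin prodr_const card_ord exprVn.
move=> k _; rewrite uniform_prob_itvco.
- by congr _%:E; rewrite -mulrBl -natrB ?subSnn ?mul1r.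
- by rewrite divr_ge0.
- by rewrite ler_pM2r ?invr_gt0// ler_nat.
- by rewrite ler_pdivrMr// mul1r ler_nat.
Qed.

Let mocc q (Q : pred {set 'I_n}) : measurable [set w | Q (occupants (grid_cell q) w)].
Proof.
apply: (measurable_finpreimage (X := occupants (grid_cell q))) => A.
exact: measurable_occupants (measurable_grid_cell q) A.
Qed.

Let mbox i : measurable [set w | box (fun=> `[0, 1[%classic) (pt w i)].
Proof. by apply: measurable_point; apply: measurable_box => k; exact: measurable_itv. Qed.

Lemma measurable_balanced : measurable [set w | balanced w].
Proof.
apply: (measurableI _ _ (measurable_forall _) (measurable_forall mbox)) => q.
exact: (mocc q (fun A => (lam / 4 <= #|A|%:R) && (#|A|%:R <= 4 * lam))).
Qed.

Lemma unbalanced_pr :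
  (P (~` [set w | balanced w]) <= ((m ^ d)%:R * (2 * expR (- (lam / 4))))%:E)%E.
Proof.
have p01 : 0 <= (m%:R ^+ d : R)^-1 <= 1.
  by rewrite invr_ge0 exprn_ge0//= invf_le1 ?exprn_gt0 ?ltr0n// exprn_ege1// ler1n.
pose F1 q := [set w | ~~ ((lam / 4 <= #|occupants (grid_cell q) w|%:R) &&
             (#|occupants (grid_cell q) w|%:R <= 4 * lam))].
pose F2 i := [set w | ~ box (fun=> `[0, 1[%classic) (pt w i)].
have mF1 q : measurable (F1 q).
  exact: (mocc q (fun A => ~~ ((lam / 4 <= #|A|%:R) && (#|A|%:R <= 4 * lam)))).
have mF2 i : measurable (F2 i) by exact: measurableC (mbox i).
have mE1 : measurable [set w | exists2 q, true & F1 q w].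
  rewrite (_ : [set w | _] = [set w | exists q, F1 q w]); first exact: measurable_exists.
  by apply/seteqP; split=> w [q]; exists q.
have mE2 : measurable [set w | exists2 i, true & F2 i w].
  rewrite (_ : [set w | _] = [set w | exists q, F2 q w]); first exact: measurable_exists.
  by apply/seteqP; split=> w [q]; exists q.
apply: (@le_trans _ _ (P ([set w | exists2 q, true & F1 q w] `|` [set w | exists2 i, true & F2 i w]))).
  rewrite le_measure ?inE//.
  - by apply: measurableC; exact: measurable_balanced.
  - exact: measurableU.
  - move=> w /= nb; apply: contrapT => /not_orP[h1 h2]; apply: nb; split=> [q|i].
      by apply: contrapT => /negP h; apply: h1; exists q.
    by apply: contrapT => h; apply: h2; exists i.
apply: le_trans (measureU2 P mE1 mE2) _; rewrite -[leRHS]adde0; apply: leeD.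
  apply: le_trans (probability_exists_le P xpredT mF1) _.
  apply: (@le_trans _ _ (\sum_(q : {ffun 'I_d -> 'I_m}) (2 * expR (- (lam / 4)))%:E)%E).
    apply: lee_sum => q _.
    exact: (chernoff_occupants (measurable_grid_cell q) p01 (grid_cell_pr q)).
  by rewrite sumEFin sumr_const card_ffun !card_ord lee_fin -[leLHS]mulr_natl.
apply: le_trans (probability_exists_le P xpredT mF2) _.
rewrite big1// => i _; rewrite /F2 -/(~` [set w | box (fun=> `[0, 1[%classic) (pt w i)]).
rewrite probability_setC// box_pr; last by move=> k; exact: measurable_itv.
rewrite big1 ?subee// => k _.
by rewrite uniform_prob_itvco// subr0.
Qed.

End Occupancy.

(** * Torus distances and grid cells *)

Section Geometry.
Variable R : realType.

Lemma torus_dist_sym d (x y : d.-tuple R) : torus_dist x y = torus_dist y x.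
Proof. by rewrite /torus_dist; congr Num.sqrt; apply: eq_bigr => k _; rewrite distrC. Qed.

(** The two arguments of the minimum correspond to the direct and the wrapped cases of [torus_near];
    taking floors changes a difference by less than one. *)
Lemma torus_near_floor (m l a b : nat) (x y : R) :
  a%:R <= m%:R * x < a.+1%:R -> b%:R <= m%:R * y < b.+1%:R ->
  m%:R * Num.min `|x - y| (1 - `|x - y|) <= l.+1%:R ->
  torus_near m l.+2 a b.
Proof.
move=> /andP[ax xa] /andP[by_ yb] h.
have nat_le (i j : nat) : i%:R < j%:R + 1 :> R -> (i <= j)%N by rewrite natr1 ltr_nat.
have m0 : 0 <= m%:R :> R by [].
rewrite -natr1 in xa; rewrite -natr1 in yb; rewrite -natr1 in h.
move: h; rewrite /torus_near minr_pMr//; case: (lerP 0 (x - y)) => s; [rewrite ger0_norm//|rewrite ltr0_norm//];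
  rewrite ?ge_min => /orP[] h.
- apply/or3P/Or31/andP; split; apply: nat_le; rewrite natrD -!natr1; nra.
- by apply/or3P/Or33; apply: nat_le; rewrite !natrD -!natr1; lra.
- apply/or3P/Or31/andP; split; apply: nat_le; rewrite natrD -!natr1; nra.
- by apply/or3P/Or32; apply: nat_le; rewrite !natrD -!natr1; lra.
Qed.

Lemma torus_term_bounds (x y : R) : 0 <= x < 1 -> 0 <= y < 1 ->
  0 <= Num.min `|x - y| (1 - `|x - y|).
Proof.
move=> /andP[x0 x1] /andP[y0 y1]; rewrite le_min normr_ge0 subr_ge0 ler_norml.
by apply/andP; split; lra.
Qed.

Lemma torus_term_le d (x y : d.-tuple R) r k :
  (forall k, 0 <= tnth x k < 1) -> (forall k, 0 <= tnth y k < 1) ->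
  torus_dist x y <= r -> Num.min `|tnth x k - tnth y k| (1 - `|tnth x k - tnth y k|) <= r.
Proof.
move=> x01 y01; apply: le_trans.
rewrite -[leLHS]ger0_norm ?torus_term_bounds// -sqrtr_sqr /torus_dist ler_wsqrtr//.
rewrite (bigD1 k)//= lerDl; apply: sumr_ge0 => i _; exact: sqr_ge0.
Qed.

Lemma torus_dist_le d (x y : d.-tuple R) a :
  (forall k, 0 <= tnth x k < 1) -> (forall k, 0 <= tnth y k < 1) -> 0 <= a ->
  (forall k, `|tnth x k - tnth y k| <= a) -> torus_dist x y <= d%:R * a.
Proof.
move=> x01 y01 a0 h.
have da0 : 0 <= d%:R * a by rewrite mulr_ge0.
rewrite -[leRHS]ger0_norm// -sqrtr_sqr /torus_dist ler_wsqrtr//.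
apply: (@le_trans _ _ (\sum_(k < d) a ^+ 2)).
  apply: ler_sum => k _; rewrite lerXn2r ?nnegrE ?torus_term_bounds//.
  by rewrite ge_min h.
rewrite sumr_const card_ord exprMn -[leLHS]mulr_natl ler_wpM2r ?sqr_ge0//.
by rewrite -natrX ler_nat; case: (d) => // k; rewrite expnS leq_pmulr ?expn_gt0.
Qed.

Variables (d n : nat) (r : R) (c : nat) (G : bluetooth_graph d n r c) (m : nat).
Hypotheses (m0 : (0 < m)%N) (d0 : (0 < d)%N) (r01 : 0 < r <= 1).
Hypothesis mr_ge : 2 * d%:R <= m%:R * r.
Hypothesis mr_le : m%:R * r <= 2 * d%:R + 1.

(** Points of adjacent cells differ by at most [2 / m] in each coordinate, hence are within
    [2 * d / m <= r]. Conversely, visible points differ by at most [m * r <= 2 * d + 1] cell sides,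
    whence the radius [2 * d + 2] after rounding. *)
Lemma balanced_cellular (w : bt_space G) : balanced m w ->
  exists cell : 'I_n -> {ffun 'I_d -> 'I_m},
    cellular (2 * d + 2) (n%:R * (m%:R ^+ d)^-1 : R) (nbr_map r (bt_points w)) cell.
Proof.
move=> [occ unit_box]; have [r0 r1] := andP r01.
have mR : 0 < m%:R :> R by rewrite ltr0n.
pose x i k : R := tnth (tnth (bt_points w) i) k.
have x01 i k : 0 <= x i k < 1 by have := unit_box i k; rewrite /= in_itv.
(* The default of [insubd] is never taken, as [m * x i k < m]. *)
pose cell i : {ffun 'I_d -> 'I_m} := [ffun k => insubd (Ordinal m0) (Num.truncn (m%:R * x i k))].
have mx0 i k : 0 <= m%:R * x i k by have /andP[? _] := x01 i k; rewrite mulr_ge0.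
have cellE i k : cell i k = Num.truncn (m%:R * x i k) :> nat.
  rewrite ffunE val_insubd truncn_lt_nat//.
  by have /andP[_ h] := x01 i k; rewrite -[ltRHS]mulr1 ltr_pM2l// h.
have cellP i k : (cell i k)%:R <= m%:R * x i k < (cell i k).+1%:R.
  by rewrite cellE truncn_itv.
have blockE q : [set v | cell v == q]%SET = occupants (grid_cell q) w.
  apply/setP => i; rewrite !finset.in_set; apply/eqP/idP => [<-|/set_mem h].
    apply/mem_set => k; rewrite /grid_itv /= in_itv/= ler_pdivrMr// ltr_pdivlMr//.
    by rewrite ![_ * m%:R]mulrC cellP.
  apply/ffunP => k; apply/val_inj; rewrite /= cellE; apply/eqP; rewrite truncn_eq//.
  have := h k; rewrite /grid_itv /= in_itv/= ler_pdivrMr// ltr_pdivlMr//.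
  by rewrite ![_ * m%:R]mulrC.
have nbrE u v : (u \in nbr_map r (bt_points w) v) =
    (v != u) && (torus_dist (tnth (bt_points w) v) (tnth (bt_points w) u) <= r).
  by rewrite ffunE finset.in_set.
exists cell; split.
- by move=> v; rewrite nbrE eqxx.
- by move=> u v; rewrite !nbrE eq_sym torus_dist_sym.
- move=> u v uv /forallP adj; rewrite nbrE eq_sym uv/=.
  have am : 0 <= 2 / m%:R :> R by rewrite divr_ge0.
  apply: le_trans (torus_dist_le (a := 2 / m%:R) (x01 v) (x01 u) am _) _; last first.
    by rewrite mulrA ler_pdivrMr// [d%:R * 2]mulrC [r * _]mulrC.
  move=> k; rewrite ler_norml -mulNr ler_pdivrMr// ler_pdivlMr//.
  have /andP[h1 h2] := cellP v k; have /andP[h3 h4] := cellP u k.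
  have /andP[] := adj k; rewrite -!(ler_nat R) -!natr1 => h5 h6.
  rewrite -!natr1 in h2 h4; rewrite -/(x v k) -/(x u k).
  by apply/andP; split; lra.
- move=> u v; rewrite nbrE => /andP[_ uv]; apply/forallP => k.
  rewrite addn2; apply: (torus_near_floor (cellP v k) (cellP u k)).
  have := torus_term_le k (x01 v) (x01 u) uv; rewrite -/(x v k) -/(x u k).
  move=> /(ler_wpM2l (ltW mR)) h; apply: (le_trans h); apply: (le_trans mr_le).
  by rewrite -[leRHS]natr1 natrM.
- by move=> q; rewrite blockE; have /andP[] := occ q.
- by move=> q; rewrite blockE; have /andP[] := occ q.
Qed.

End Geometry.

(** * Asymptotics *)

Section Asymptotics.
Variable R : realType.

Lemma near_powR_ge (s M : R) : 0 < s -> \forall n \near \oo, M <= n%:R `^ s.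
Proof.
move=> s0; pose M1 := Num.max M 1; have M10 : 0 <= M1 by rewrite le_max ler01 orbT.
near=> n; apply: (@le_trans _ _ M1); first by rewrite le_max lexx.
have -> : M1 = (M1 `^ s^-1) `^ s by rewrite -powRrM mulVf ?gt_eqF// powRr1.
apply: ge0_ler_powR; rewrite ?nnegrE ?powR_ge0 ?(ltW s0)//.
by near: n; exact: nbhs_infty_ger.
Unshelve. all: by end_near. Qed.

Variables (d : nat) (d0 : (0 < d)%N) (gamma : R) (gamma_gt0 : 0 < gamma).
Variables (gamma_ : nat -> R) (delta : R) (delta01 : 0 < delta < 1).
Hypothesis gamma_equiv : gamma_ n / gamma @[n --> \oo] --> (1 : R).

Local Notation r := (bt_radius d gamma_ delta).

(** The product of this size with [r n] lies between [2 * d] and [2 * d + 1] as soon as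
    [0 < r n <= 1]. *)
Definition grid_size (n : nat) : nat := (Num.truncn (2 * d%:R / r n)).+1.

Definition cell_mass (n : nat) : R := n%:R * ((grid_size n)%:R ^+ d)^-1.

Lemma near_gamma : \forall n \near \oo, gamma / 2 <= gamma_ n <= 2 * gamma.
Proof.
have half0 : 0 < 2^-1 :> R by rewrite invr_gt0.
have h := (cvgrPdist_le _ _).1 gamma_equiv _ half0.
near=> n; have : `|1 - gamma_ n / gamma| <= 2^-1 by near: n; exact: h.
rewrite ler_distlC => /andP[h1 h2].
rewrite ler_pdivlMr// in h1; rewrite ler_pdivrMr// in h2.
by have g0 := gamma_gt0; apply/andP; split; lra.
Unshelve. all: by end_near. Qed.

Lemma bt_radiusX n : (0 < n)%N -> r n ^+ d * n%:R = gamma_ n ^+ d * n%:R `^ delta.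
Proof.
move=> n0; rewrite /bt_radius exprMn -mulrA; congr (_ * _).
have nR : 0 < n%:R :> R by rewrite ltr0n.
rewrite -powR_mulrn ?powR_ge0// -powRrM.
rewrite -[X in _ * X = _](powRr1 (ltW nR)) -powRD; last by rewrite (gt_eqF nR) implybT.
congr (_ `^ _); field; first by rewrite pnatr_eq0 -lt0n.
Qed.

Lemma near_grid : \forall n \near \oo,
  [/\ 0 < r n <= 1, 2 * d%:R <= (grid_size n)%:R * r n & (grid_size n)%:R * r n <= 2 * d%:R + 1].
Proof.
have [dl0 dl1] := andP delta01.
have dR : 0 < d%:R :> R by rewrite ltr0n.
have s0 : 0 < (1 - delta) / d%:R by rewrite divr_gt0// subr_gt0.
near=> n.
have /andP[g1 g2] : gamma / 2 <= gamma_ n <= 2 * gamma by near: n; exact: near_gamma.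
have h : 2 * gamma <= n%:R `^ ((1 - delta) / d%:R) by near: n; exact: near_powR_ge.
have r0 : 0 < r n.
  rewrite mulr_gt0//; first by apply: lt_le_trans g1; rewrite divr_gt0.
  by rewrite powR_gt0// ltr0n; near: n; exact: nbhs_infty_gt.
have r1 : r n <= 1.
  rewrite /bt_radius powRN ler_pdivrMr ?mul1r; first exact: le_trans g2 h.
  by apply: lt_le_trans h; rewrite mulr_gt0.
have q0 : 0 <= 2 * d%:R / r n by rewrite divr_ge0 ?(ltW r0)// mulr_ge0.
split; first by rewrite r0.
  by rewrite -ler_pdivrMr// ltW// truncnS_gt.
rewrite /grid_size -natr1 mulrDl mul1r lerD// -ler_pdivlMr//.
by rewrite truncn_le.
Unshelve. all: by end_near. Qed.

(** The mass equals [(gamma_ n / (m * r n)) ^+ d] times the power [delta] of [n], and both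
    [gamma_ n] and [m * r n] stay between positive constants. *)
Lemma near_cell_mass : exists a1 a2 : R, [/\ 0 < a1, 0 < a2 &
  \forall n \near \oo, a1 * n%:R `^ delta <= cell_mass n <= a2 * n%:R `^ delta].
Proof.
have dR : 1 <= d%:R :> R by rewrite ler1n.
exists ((gamma / 2 / (2 * d%:R + 1)) ^+ d), ((2 * gamma / (2 * d%:R)) ^+ d); split.
- by rewrite exprn_gt0// !divr_gt0//; lra.
- by rewrite exprn_gt0// divr_gt0 ?mulr_gt0//; lra.
near=> n.
have /andP[g1 g2] : gamma / 2 <= gamma_ n <= 2 * gamma by near: n; exact: near_gamma.
have [/andP[r0 r1] m1 m2] : [/\ 0 < r n <= 1, 2 * d%:R <= (grid_size n)%:R * r n &
    (grid_size n)%:R * r n <= 2 * d%:R + 1] by near: n; exact: near_grid.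
have n0 : (0 < n)%N by near: n; exact: nbhs_infty_gt.
have m0 : 0 < (grid_size n)%:R :> R by rewrite ltr0n.
set m : R := (grid_size n)%:R in m0 m1 m2 *.
have E : cell_mass n = (gamma_ n / (m * r n)) ^+ d * n%:R `^ delta.
  rewrite expr_div_n [RHS]mulrAC -bt_radiusX// (_ : cell_mass n = n%:R / m ^+ d)//.
  move: (r n) r0 {r1 m1 m2} => rn rn0; rewrite exprMn; field.
  by rewrite !expf_neq0// gt_eqF.
have nd0 : 0 <= n%:R `^ delta by rewrite powR_ge0.
have gn0 : 0 <= gamma_ n by lra.
have g0 := gamma_gt0; have mr0 : 0 < m * r n by rewrite mulr_gt0.
rewrite E; apply/andP; split; rewrite ler_wpM2r// lerXn2r ?nnegrE ?divr_ge0 ?(ltW mr0)//.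
- by lra.
- rewrite ler_pM ?invr_ge0//; first by lra.
  by rewrite lef_pV2 ?posrE//; lra.
- by lra.
- rewrite ler_pM ?invr_ge0 ?(ltW mr0)//.
  by rewrite lef_pV2 ?posrE//; lra.
Unshelve. all: by end_near. Qed.

Lemma near_cell_mass_ge (X : R) : \forall n \near \oo, X <= cell_mass n.
Proof.
have [a1 [a2 [a10 a20 ha]]] := near_cell_mass; have [dl0 _] := andP delta01.
near=> n; have /andP[h1 _] : a1 * n%:R `^ delta <= cell_mass n <= a2 * n%:R `^ delta.
  by near: n.
apply: le_trans h1; rewrite mulrC -ler_pdivrMr//.
by near: n; exact: near_powR_ge.
Unshelve. all: by end_near. Qed.

Lemma near_cell_massX_le (k : nat) (tau : R) : k%:R * delta < 1 ->
  \forall n \near \oo, tau * cell_mass n ^+ k <= n%:R.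
Proof.
move=> kd; have [a1 [a2 [a10 a20 ha]]] := near_cell_mass.
(* [tau] comes without a sign, and monotonicity in the cell mass needs a nonnegative factor. *)
pose tau1 := Num.max tau 0; have t0 : 0 <= tau1 by rewrite le_max lexx orbT.
near=> n; have /andP[h1 h2] : a1 * n%:R `^ delta <= cell_mass n <= a2 * n%:R `^ delta.
  by near: n.
have h3 : tau1 * a2 ^+ k <= n%:R `^ (1 - k%:R * delta).
  by near: n; apply: near_powR_ge; rewrite subr_gt0.
have n0 : 0 < n%:R :> R by rewrite ltr0n; near: n; exact: nbhs_infty_gt.
have l0 : 0 <= cell_mass n by apply: le_trans h1; rewrite mulr_ge0 ?powR_ge0 ?ltW.
apply: (@le_trans _ _ (tau1 * cell_mass n ^+ k)).
  by rewrite ler_wpM2r ?exprn_ge0// le_max lexx.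
apply: (@le_trans _ _ (tau1 * (a2 * n%:R `^ delta) ^+ k)).
  by rewrite ler_wpM2l// lerXn2r ?nnegrE// mulr_ge0 ?powR_ge0 ?ltW.
rewrite exprMn mulrA -[(n%:R `^ delta) ^+ k]powR_mulrn ?powR_ge0// -powRrM.
rewrite -[leRHS](powRr1 (ltW n0)) -[X in _ <= _ `^ X](subrK (delta * k%:R)).
rewrite powRD; last by rewrite (gt_eqF n0) implybT.
by rewrite ler_wpM2r ?powR_ge0// [delta * _]mulrC.
Unshelve. all: by end_near. Qed.

Lemma near_cell_massX_ge (k : nat) (tau : R) : 0 < tau -> 1 < k%:R * delta ->
  \forall n \near \oo, n%:R <= tau * cell_mass n ^+ k.
Proof.
move=> t0 kd; have [a1 [a2 [a10 a20 ha]]] := near_cell_mass.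
near=> n; have /andP[h1 h2] : a1 * n%:R `^ delta <= cell_mass n <= a2 * n%:R `^ delta.
  by near: n.
have h3 : (tau * a1 ^+ k)^-1 <= n%:R `^ (k%:R * delta - 1).
  by near: n; apply: near_powR_ge; rewrite subr_gt0.
have n0 : 0 < n%:R :> R by rewrite ltr0n; near: n; exact: nbhs_infty_gt.
apply: (@le_trans _ _ (tau * (a1 * n%:R `^ delta) ^+ k)); last first.
  have a1n : 0 <= a1 * n%:R `^ delta by rewrite mulr_ge0 ?powR_ge0 ?ltW.
  by rewrite ler_wpM2l ?(ltW t0)// lerXn2r ?nnegrE// (le_trans a1n).
rewrite exprMn mulrA -[(n%:R `^ delta) ^+ k]powR_mulrn ?powR_ge0// -powRrM [delta * _]mulrC.
rewrite -[X in _ `^ X](subrK 1) powRD; last by rewrite (gt_eqF n0) implybT.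
rewrite powRr1 ?(ltW n0)// mulrA ler_peMl ?(ltW n0)//.
by move: h3; rewrite -[leLHS]mulr1 ler_pdivrMl// mulr_gt0 ?exprn_gt0.
Unshelve. all: by end_near. Qed.

(** There are at most [n] cells, and [n] is at most a fixed power of the cell mass once the exponent
    exceeds [1 / delta]; the exponential beats this power. *)
Lemma near_unbalanced (eps : R) : 0 < eps ->
  \forall n \near \oo, (grid_size n ^ d)%:R * (2 * expR (- (cell_mass n / 4))) <= eps.
Proof.
move=> eps0; have [dl0 dl1] := andP delta01.
pose k := (Num.truncn delta^-1).+1.
have kd : 1 < k%:R * delta by rewrite -ltr_pdivrMr// mul1r truncnS_gt.
have e0 : 0 < eps / 2 / 4 ^+ k by rewrite !divr_gt0 ?exprn_gt0.
have [x0 [x00 hx]] := exprMexpRN_small k e0.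
near=> n.
have l1 : 1 <= cell_mass n by near: n; exact: near_cell_mass_ge.
have lx : 4 * x0 <= cell_mass n by near: n; exact: near_cell_mass_ge.
have nl : n%:R <= 1 * cell_mass n ^+ k by near: n; exact: near_cell_massX_ge.
rewrite mul1r in nl; have l0 : 0 < cell_mass n by apply: lt_le_trans l1.
have mn : (grid_size n ^ d)%:R <= cell_mass n ^+ k.
  apply: le_trans nl; rewrite natrX -[leLHS]mul1r.
  have m0 : 0 < (grid_size n)%:R ^+ d :> R by rewrite exprn_gt0// ltr0n.
  by move: l1; rewrite /cell_mass ler_pdivlMr.
apply: (le_trans (ler_wpM2r _ mn)); first by rewrite mulr_ge0// expR_ge0.
have h : (cell_mass n / 4) ^+ k * expR (- (cell_mass n / 4)) <= eps / 2 / 4 ^+ k.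
  by apply: hx; rewrite ler_pdivlMr// mulrC.
have p4 : 0 < 4 ^+ k :> R by rewrite exprn_gt0.
move: h; rewrite expr_div_n mulrAC ler_pM2r ?invr_gt0// => h.
by move: h; lra.
Unshelve. all: by end_near. Qed.

End Asymptotics.

(** * The two regimes for the random graph *)

Section Regimes.
Variables (R : realType) (d : nat) (d0 : (0 < d)%N) (gamma : R) (gamma_gt0 : 0 < gamma).
Variables (gamma_ : nat -> R) (gamma_equiv : gamma_ n / gamma @[n --> \oo] --> (1 : R)).
Variable Gam : forall (n : nat) (r : R) (c : nat), bluetooth_graph d n r c.
Variables (delta : R) (delta01 : 0 < delta < 1).
Local Notation r := (bt_radius d gamma_ delta).
Local Notation lam := (cell_mass d gamma_ delta).

Lemma connectedbP n (s : {ffun 'I_n -> {set 'I_n}}) :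
  reflect (graph_connected (selected_adj s)) (connectedb s).
Proof.
apply: (iffP forallP) => [h i j|h i]; first exact: (forallP (h i)).
by apply/forallP => j; exact: h.
Qed.

(** Half of [eps] covers unbalanced configurations; balanced ones are cellular, and the bound for
    fixed graphs takes the other half. *)
Lemma near_choices_pr_le (c : nat) (D : forall n, pred {ffun 'I_n -> {set 'I_n}}) (eps : R) :
  0 < eps ->
  (\forall n \near \oo, forall (g : {ffun 'I_n -> {set 'I_n}})
    (cell : 'I_n -> {ffun 'I_d -> 'I_(grid_size d gamma_ delta n)}),
    cellular (2 * d + 2) (lam n) g cell -> graph_pr R c g (D n) <= eps / 2) ->
  \forall n \near \oo,
    (bt_prob (Gam n (r n) c) [set w | D n (bt_choices w)] <= eps%:E)%E.
Proof.
move=> eps0 hD; have eps2 : 0 < eps / 2 by rewrite divr_gt0.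
near=> n.
have [r01 m1 m2] : [/\ 0 < r n <= 1, 2 * d%:R <= (grid_size d gamma_ delta n)%:R * r n &
    (grid_size d gamma_ delta n)%:R * r n <= 2 * d%:R + 1].
  by near: n; exact: (near_grid d0 gamma_gt0 delta01 gamma_equiv).
have hn : forall (g : {ffun 'I_n -> {set 'I_n}})
    (cell : 'I_n -> {ffun 'I_d -> 'I_(grid_size d gamma_ delta n)}),
    cellular (2 * d + 2) (lam n) g cell -> graph_pr R c g (D n) <= eps / 2 by near: n.
have ub : (grid_size d gamma_ delta n ^ d)%:R * (2 * expR (- (lam n / 4))) <= eps / 2.
  by near: n; exact: (near_unbalanced d0 gamma_gt0 delta01 gamma_equiv).
pose E := [set w | balanced (G := Gam n (r n) c) (grid_size d gamma_ delta n) w].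
apply: le_trans (@choices_pr_le _ _ _ _ _ (Gam n (r n) c) (D n) E (eps / 2) _ (ltW eps2) _) _.
- exact: measurable_balanced.
- move=> w /(balanced_cellular (ltn0Sn _) r01 m1 m2)[cell]; exact: hn.
- rewrite [eps in leRHS](_ : eps = eps / 2 + eps / 2); last by lra.
  rewrite EFinD leeD2r//; apply: le_trans (unbalanced_pr _ _) _ => //.
Unshelve. all: by end_near. Qed.

Lemma near_disconnected (c : nat) (eps : R) : 0 < eps -> (c ^ 2)%:R * delta < 1 ->
  \forall n \near \oo, (prob_connected (Gam n (r n) c) <= eps%:E)%E.
Proof.
move=> eps0 cd; have eps2 : 0 < eps / 2 by rewrite divr_gt0.
have [lam0 [tau H]] := @cellular_disconnected R d (2 * d + 2) c _ eps2.
under eq_near => n.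
  rewrite /prob_connected (_ : [set w | _] = [set w | connectedb (bt_choices (b := Gam n (r n) c) w)]).
    over.
  by apply/seteqP; split=> w /connectedbP.
apply: (@near_choices_pr_le c (fun n s => connectedb s)) => //.
near=> n => g cell Hc; apply: (H _ _ _ _ _ Hc).
  by near: n; exact: (near_cell_mass_ge d0 gamma_gt0 delta01 gamma_equiv).
rewrite card_ord.
by near: n; exact: (near_cell_massX_le d0 gamma_gt0 delta01 gamma_equiv).
Unshelve. all: by end_near. Qed.

Lemma near_connected (c : nat) (eps : R) : 0 < eps -> 1 < (c ^ 2)%:R * delta ->
  (forall eps : R, 0 < eps -> exists lam0 tau : R, 0 < tau /\
    forall (m : nat) (V : finType) (lam : R) (g : V -> {set V}) (cell : V -> {ffun 'I_d -> 'I_m}),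
    cellular (2 * d + 2) lam g cell -> lam0 <= lam -> #|V|%:R <= tau * lam ^+ (c ^ 2) ->
    graph_pr R c g [pred s | ~~ connectedb s] <= eps) ->
  \forall n \near \oo, (prob_disconnected (Gam n (r n) c) <= eps%:E)%E.
Proof.
move=> eps0 cd con; have eps2 : 0 < eps / 2 by rewrite divr_gt0.
have [lam0 [tau [tau0 H]]] := con _ eps2.
under eq_near => n.
  rewrite /prob_disconnected (_ : [set w | _] = [set w | ~~ connectedb (bt_choices (b := Gam n (r n) c) w)]).
    over.
  by apply/seteqP; split=> w => [h|/connectedbP//]; apply/negP => /connectedbP.
apply: (@near_choices_pr_le c (fun n s => ~~ connectedb s)) => //.
near=> n => g cell Hc; apply: (H _ _ _ _ _ Hc).
  by near: n; exact: (near_cell_mass_ge d0 gamma_gt0 delta01 gamma_equiv).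
rewrite card_ord.
by near: n; exact: (near_cell_massX_ge d0 gamma_gt0 delta01 gamma_equiv).
Unshelve. all: by end_near. Qed.

End Regimes.

(** * Limits and location of the thresholds *)

Section Limits.
Variable R : realType.

Lemma prob_connectedC d n r c (G : bluetooth_graph (R := R) d n r c) :
  exists2 p : R, 0 <= p <= 1 &
    prob_connected G = p%:E /\ prob_disconnected G = (1 - p)%:E.
Proof.
have mC : measurable [set w | graph_connected (selected_adj (bt_choices (b := G) w))].
  rewrite (_ : [set w | _] = [set w | connectedb (bt_choices (b := G) w)]).
    exact: (@measurable_choices _ _ _ _ _ G (fun s => connectedb s)).
  by apply/seteqP; split=> w /connectedbP.
have pE := probability_finE mC; set p := fine _ in pE.
exists p; first by rewrite -!lee_fin -pE measure_ge0 probability_le1.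
split=> //; rewrite /prob_disconnected EFinB -pE -probability_setC//.
Qed.

Lemma cvg_prob1 (u v : nat -> \bar R) :
  (forall n, exists2 p : R, 0 <= p <= 1 & u n = p%:E /\ v n = (1 - p)%:E) ->
  (forall eps : R, 0 < eps -> \forall n \near \oo, (u n <= eps%:E)%E) ->
  v n @[n --> \oo] --> 1%E.
Proof.
move=> uv u0; apply/fine_cvgP; split.
  by apply: nearW => n; have [p _ [_ ->]] := uv n.
apply/cvgrPdist_le => eps eps0; near=> n.
have : (u n <= eps%:E)%E by near: n; exact: u0.
have [p /andP[p0 p1] [-> /= ->]] := uv n.
by rewrite lee_fin /= opprB addrC subrK ger0_norm.
Unshelve. all: by end_near. Qed.

Lemma not_cvg_prob1 (u v : nat -> \bar R) :
  (forall n, exists2 p : R, 0 <= p <= 1 & u n = p%:E /\ v n = (1 - p)%:E) ->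
  (forall eps : R, 0 < eps -> \forall n \near \oo, (u n <= eps%:E)%E) ->
  ~ (u n @[n --> \oo] --> 1%E).
Proof.
move=> uv u0 /fine_cvgP[_ /cvgrPdist_le h].
have e4 : 0 < 4^-1 :> R by rewrite invr_gt0.
suff : \forall n \near \oo, False by case/filter_ex.
near=> n; have : `|1 - (fine \o u) n| <= 4^-1 by near: n; exact: h.
have : (u n <= 4^-1%:E)%E by near: n; exact: u0.
have [p _ [/= -> _]] := uv n; rewrite lee_fin /= ler_norml => h1 /andP[h2 h3]; lra.
Unshelve. all: by end_near. Qed.

Lemma powRN2_sqr (delta : R) : 0 < delta -> (delta `^ (- 2^-1)) ^+ 2 = delta^-1.
Proof.
move=> delta0; rewrite -powR_mulrn ?powR_ge0// -powRrM mulNr mulVf ?pnatr_eq0//.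
by rewrite powR_inv1// ltW.
Qed.

Lemma near0_powRN_ge (M : R) : \forall delta \near (0 : R)^'+, M <= delta `^ (- 2^-1).
Proof.
pose M1 := Num.max M 1; have M10 : 0 < M1 by rewrite lt_max ltr01 orbT.
near=> delta; have delta0 : 0 < delta by near: delta; exact: nbhs_right_gt.
have dM : delta < (M1 ^+ 2)^-1 by near: delta; apply: nbhs_right_lt; rewrite invr_gt0 exprn_gt0.
apply: (@le_trans _ _ M1); first by rewrite le_max lexx.
rewrite -(ler_pXn2r (_ : 0 < 2)%N) ?nnegrE ?powR_ge0 ?(ltW M10)// powRN2_sqr//.
by rewrite -[leLHS]invrK lef_pV2 ?posrE ?invr_gt0 ?exprn_gt0// ltW.
Unshelve. all: by end_near. Qed.

End Limits.

Theorem theorem2 (R : realType) (d : nat) (d_ge1 : (1 <= d)%N)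
    (gamma : R) (gamma_gt0 : 0 < gamma)
    (gamma_ : nat -> R) (gamma_pos : forall n, 0 < gamma_ n)
    (gamma_equiv : gamma_ n / gamma @[n --> \oo] --> (1 : R))
    (Gam : forall (n : nat) (r : R) (c : nat), bluetooth_graph d n r c)
    (eps : R) (eps_gt0 : 0 < eps) :
  \forall delta \near (0 : R)^'+,
    0 < delta < 1 ->
    exists c_low c_high : nat,
      [/\ is_largest (fun c =>
            prob_disconnected (Gam n (bt_radius d gamma_ delta n) c)
              @[n --> \oo] --> 1%E) c_low,
          is_smallest (fun c =>
            prob_connected (Gam n (bt_radius d gamma_ delta n) c)
              @[n --> \oo] --> 1%E) c_high,
          (1 - eps) * delta `^ (- 2^-1) <= c_low%:R,
          (c_low <= c_high)%N
        & c_high%:R <= (1 + eps) * delta `^ (- 2^-1)].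
Proof.
have [c0 Hc0] := @cellular_connected R d (2 * d + 2).
near=> delta.
(* This puts every [c] above [delta ^ (-1/2)] in the range of [cellular_connected]. The next bound
   gives [1 <= eps * s], which absorbs the rounding to integers. *)
have s_c0 : c0%:R <= delta `^ (- 2^-1) by near: delta; exact: near0_powRN_ge.
have s_eps : eps^-1 <= delta `^ (- 2^-1) by near: delta; exact: near0_powRN_ge.
have s1 : 1 <= delta `^ (- 2^-1) by near: delta; exact: near0_powRN_ge.
move=> delta01; have [delta0 delta1] := andP delta01.
have s2 := powRN2_sqr delta0.
move: (delta `^ (- 2^-1)) s_c0 s_eps s1 s2 => s s_c0 s_eps s1 s2.
have s0 : 0 < s by apply: lt_le_trans s1.
have eps_s : 1 <= eps * s by move: s_eps; rewrite -[leLHS]mulr1 ler_pdivrMl.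
pose Qd c := prob_disconnected (Gam n (bt_radius d gamma_ delta n) c) @[n --> \oo] --> 1%E.
pose Qc c := prob_connected (Gam n (bt_radius d gamma_ delta n) c) @[n --> \oo] --> 1%E.
rewrite -/Qd -/Qc.
have below c : c%:R < s -> (c ^ 2)%:R * delta < 1.
  by move=> cs; rewrite -ltr_pdivlMr// mul1r -s2 natrX ltrXn2r ?nnegrE ?(ltW s0).
have above c : s < c%:R -> 1 < (c ^ 2)%:R * delta.
  by move=> cs; rewrite -ltr_pdivrMr// mul1r -s2 natrX ltrXn2r ?nnegrE ?(ltW s0).
have uv c n : exists2 p : R, 0 <= p <= 1 &
    prob_connected (Gam n (bt_radius d gamma_ delta n) c) = p%:E /\
    prob_disconnected (Gam n (bt_radius d gamma_ delta n) c) = (1 - p)%:E.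
  exact: prob_connectedC.
have vu c n : exists2 p : R, 0 <= p <= 1 &
    prob_disconnected (Gam n (bt_radius d gamma_ delta n) c) = p%:E /\
    prob_connected (Gam n (bt_radius d gamma_ delta n) c) = (1 - p)%:E.
  have [p /andP[p0 p1] [-> ->]] := uv c n; exists (1 - p); first by apply/andP; split; lra.
  by split=> //; congr _%:E; lra.
have to0 c : c%:R < s -> forall e : R, 0 < e -> \forall n \near \oo,
    (prob_connected (Gam n (bt_radius d gamma_ delta n) c) <= e%:E)%E.
  move=> cs e e0; exact: (near_disconnected d_ge1 gamma_gt0 gamma_equiv Gam delta01 e0 (below _ cs)).
have to1 c : s < c%:R -> forall e : R, 0 < e -> \forall n \near \oo,
    (prob_disconnected (Gam n (bt_radius d gamma_ delta n) c) <= e%:E)%E.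
  move=> cs e e0.
  apply: (near_connected d_ge1 gamma_gt0 gamma_equiv Gam delta01 e0 (above _ cs)).
  by apply: Hc0; rewrite -(ler_nat R) (le_trans s_c0)// ltW.
have Qd_below c : c%:R < s -> Qd c by move=> cs; exact: (cvg_prob1 (uv c) (to0 c cs)).
have Qc_above c : s < c%:R -> Qc c by move=> cs; exact: (cvg_prob1 (vu c) (to1 c cs)).
have Qd_le c : Qd c -> c%:R <= s.
  move=> Qdc; rewrite leNgt; apply/negP => sc.
  exact: (not_cvg_prob1 (vu c) (to1 c sc) Qdc).
have Qc_ge c : Qc c -> s <= c%:R.
  move=> Qcc; rewrite leNgt; apply/negP => cs.
  exact: (not_cvg_prob1 (uv c) (to0 c cs) Qcc).
(* [c1] is the largest integer strictly below [s]: when [s] is an integer, the behaviour at [c = s]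
   is not decided, so one step down is taken. *)
have [c1 c1s sc1] : exists2 c1 : nat, c1%:R < s & s <= c1.+1%:R.
  have /andP[t1 t2] := truncn_itv (ltW s0); set t := Num.truncn s in t1 t2.
  case: (ltgtP t%:R s) t1 => // [ts|ts] _; first by exists t => //; exact: ltW.
  have t0 : (0 < t)%N by rewrite -(ltr0n R) ts.
  by exists t.-1; rewrite ?prednK// -?ts// ltr_nat prednK.
have exd : exists c, `[< Qd c >] by exists c1; apply/asboolP; exact: Qd_below.
have exc : exists c, `[< Qc c >].
  exists c1.+2; apply/asboolP/Qc_above; apply: le_lt_trans sc1 _.
  by rewrite ltr_nat.
have bd c : `[< Qd c >] -> (c <= c1.+1)%N.
  by move=> /asboolP/Qd_le cs; rewrite -(ler_nat R) (le_trans cs).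
exists (ex_maxn exd bd), (ex_minn exc).
case: ex_maxnP => l /asboolP Ql lmax; case: ex_minnP => h /asboolP Qh hmin.
rewrite -natr1 in sc1.
split.
- by split=> // c Qdc; apply: lmax; exact/asboolP.
- by split=> // c Qcc; apply: hmin; exact/asboolP.
(* Here [l >= c1 >= s - 1], which is at least [(1 - eps) * s]. *)
- have : (c1 <= l)%N by apply: lmax; apply/asboolP; exact: Qd_below.
  rewrite -(ler_nat R); lra.
- by rewrite -(ler_nat R) (le_trans (Qd_le _ Ql))// Qc_ge.
(* The first integer above [s] already gives connection, so [h <= s + 1 <= (1 + eps) * s]. *)
- pose t := Num.truncn s; have /andP[t1 t2] := truncn_itv (ltW s0).
  have : (h <= t.+1)%N by apply: hmin; apply/asboolP; exact: Qc_above.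
  by rewrite -(ler_nat R) -natr1; lra.
Unshelve. all: by end_near. Qed.
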